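(* Suppose the sensor messages take values in a finite alphabet $\{0,1,\dots,l-1\}$ with $l\ge2$. Then for each $m=0,\dots,M-1$ a maximin quantizer $\bar\phi^{\max}_m$ exists and can be realized as a randomization of at most $M-1$ deterministic quantizers. Moreover, for every $m$ there is a sequence of quantizers $\{\bar\phi_{m,i}\}_{i\ge1}$, each a randomization of at most $M-1$ ULQs, such that $I(m;\bar\phi_{m,i})\to I(m)$ as $i\to\infty$.
   Context: Setting: a raw observation $X$ has, under state $m\in\{0,\dots,M-1\}$ (probability $\mathbf P_m$), density $f_m$ with respect to a common $\sigma$-finite measure. Standing assumption: for all $m\neq m'$, $0<\mathbf E_m[\log(f_m(X)/f_{m'}(X))]<\infty$. A deterministic quantizer is a measurable map $\phi$ from the observation space to $\{0,\dots,l-1\}$; $\Phi$ is their set. A randomized quantizer $\bar\phi=\sum_j p^j\phi^j$ is a probability distribution $(p^j)$ on a countable set $\{\phi^j\}\subset\Phi$; $\bar\Phi$ is the set of all quantizers (deterministic ones included as point masses). $f_m(u;\phi)=\mathbf P_m(\phi(X)=u)$, $I(m,m';\phi)=\sum_{u=0}^{l-1}f_m(u;\phi)\log\frac{f_m(u;\phi)}{f_{m'}(u;\phi)}$, $I(m,m';\bar\phi)=\sum_jp^jI(m,m';\phi^j)$, $I(m;\bar\phi)=\min_{m'\neq m}I(m,m';\bar\phi)$, $I(m)=\sup_{\bar\phi\in\bar\Phi}I(m;\bar\phi)$; a maximin quantizer for $m$ is a $\bar\phi$ with $I(m;\bar\phi)=I(m)$. A deterministic quantizer $\phi$ is an unambiguous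 likelihood quantizer (ULQ) if there are reals $\{a_{i,m}:0\le i\le l-1,\,0\le m\le M-1\}$ with $\phi(X)=\arg\min_{0\le i\le l-1}\sum_{m}a_{i,m}f_m(X)$ and the probability of a tie in this minimum is zero under every $\mathbf P_m$. *)

(* Defs.v *)
From HB Require Import structures.
From mathcomp Require Import all_boot all_order all_algebra.
From mathcomp Require Import all_classical all_reals all_analysis.
Set Implicit Arguments. Unset Strict Implicit. Unset Printing Implicit Defensive.
Import Order.TTheory GRing.Theory Num.Theory.
Local Open Scope classical_set_scope.
Local Open Scope ring_scope.

Section Quantizers.
Context {R : realType} {d : measure_display} {T : measurableType d}.
Variable mu : {measure set T -> \bar R}.
Variables (M l : nat).
(* f m : density of observation under state m w.r.t. mu *)
Variable f : 'I_M -> T -> R.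

(* integrand of E_m[log(f_m(X)/f_m'(X))] against mu (i.e. f_m log(f_m/f_m')),
   with the conventions 0 log(0/.) = 0 and a log(a/0) = +oo for a > 0 *)
Definition kl_integrand (m m' : 'I_M) (x : T) : \bar R :=
  if f m x == 0 then 0%E
  else if f m' x == 0 then +oo%E
  else (f m x * ln (f m x / f m' x))%:E.

Definition is_quantizer (phi : T -> 'I_l) : Prop :=
  forall u : 'I_l, measurable (phi @^-1` [set u]).

Definition fq (m : 'I_M) (phi : T -> 'I_l) (u : 'I_l) : R :=
  fine (\int[mu]_(x in phi @^-1` [set u]) (f m x)%:E)%E.

Definition Idet (m m' : 'I_M) (phi : T -> 'I_l) : R :=
  \sum_(u < l) (if fq m phi u == 0 then 0
                else fq m phi u * ln (fq m phi u / fq m' phi u)).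

Definition is_rq (p : nat -> R) (phi : nat -> T -> 'I_l) : Prop :=
  [/\ forall j, 0 <= p j,
      (\sum_(j <oo) (p j)%:E)%E = 1%E &
      forall j, is_quantizer (phi j)].

Definition Irand (m m' : 'I_M) (p : nat -> R) (phi : nat -> T -> 'I_l) : \bar R :=
  (\sum_(j <oo) (p j * Idet m m' (phi j))%:E)%E.

Definition Imin (m : 'I_M) (p : nat -> R) (phi : nat -> T -> 'I_l) : \bar R :=
  \big[Order.min/+oo%E]_(m' < M | m' != m) Irand m m' p phi.

Definition Isup (m : 'I_M) : \bar R :=
  ereal_sup [set Imin m pphi.1 pphi.2 | pphi in [set pphi | is_rq pphi.1 pphi.2]].

Definition lscore (a : 'I_l -> 'I_M -> R) (i : 'I_l) (x : T) : R :=
  \sum_(m < M) a i m * f m x.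

Definition tie_set (a : 'I_l -> 'I_M -> R) : set T :=
  [set x | exists i j : 'I_l, i != j /\ lscore a i x = lscore a j x /\
           forall k, lscore a i x <= lscore a k x].

Definition is_ULQ (phi : T -> 'I_l) : Prop :=
  is_quantizer phi /\
  exists a : 'I_l -> 'I_M -> R,
    (forall x k, lscore a (phi x) x <= lscore a k x) /\
    forall m : 'I_M,
      (\int[mu]_(x in tie_set a) (f m x)%:E)%E = 0%E.

End Quantizers.

(* Main.v *)
Require Import Defs.
From HB Require Import structures.
From mathcomp Require Import all_boot all_order all_algebra.
From mathcomp Require Import all_classical all_reals all_analysis.
From mathcomp Require Import measurable_realfun.
From mathcomp Require Import ring lra.
Import Order.TTheory GRing.Theory Num.Theory.
Import numFieldNormedType.Exports.
Local Open Scope classical_set_scope.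
Local Open Scope ring_scope.
Set Implicit Arguments. Unset Strict Implicit. Unset Printing Implicit Defensive.

(* Weak-star compactness and Lyapunov's theorem are avoided as follows.  For
   prices [lam >= 0], the function [sum_i lam_i I(m, m_i; phi)] is convex in the
   numbers [f_n(u; phi)], so it is bounded below by a linear function of them
   which is exact at a given quantizer.  A linear function is maximised by a
   pointwise argmin of scores, and after a generic perturbation of the scores
   ties are null; hence ULQs do as well as any quantizer at every price vector.
   A minimax argument in dimension [M - 1] turns this into mixtures of ULQs
   whose worst-case information approaches [I(m)], and a Caratheodory step keeps
   [M - 1] of them.
   For existence, the score vectors of an optimising sequence of such mixtures
   have a subsequence along which every linear form has an eventually constant
   sign.  The corresponding ULQs then converge almost everywhere to deterministic
   quantizers, and the informations are upper semicontinuous along this limit. *)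

(** * Subsequences and signs of linear forms *)

Lemma increasing_seq_cvgn (s : nat -> nat) : increasing_seq s -> s @ \oo --> \oo.
Proof.
move=> si A [N _ NA]; exists N => // n /= Nn; apply: NA => /=.
apply: leq_trans Nn _; elim: n => // n IH; apply: leq_ltn_trans IH _.
by move/increasing_seqP : si; apply.
Qed.

Lemma increasing_seq_comp (s t : nat -> nat) :
  increasing_seq s -> increasing_seq t -> increasing_seq (s \o t).
Proof. by move=> si ti m n /=; rewrite (si (t m)) -leEnat ti. Qed.

Lemma cvg_sumr (R : realType) (I : Type) (r : seq I) (u : I -> nat -> R)
    (c : I -> R) : (forall i, u i n @[n --> \oo] --> c i) ->
  (\sum_(i <- r) u i n) @[n --> \oo] --> \sum_(i <- r) c i.
Proof.
move=> uc; elim: r => [|i r IH].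
  by rewrite big_nil; under eq_fun do rewrite big_nil; exact: cvg_cst.
by rewrite big_cons; under eq_fun do rewrite big_cons; exact: cvgD.
Qed.

(** The coordinates are treated one after the other, each refining the subsequence found so far;
    limits already obtained survive the refinement. *)
Lemma bolzano_weierstrass_fin (R : realType) (I : finType) (d : nat -> I -> R)
    (B : R) : (forall n i, `|d n i| <= B) ->
  exists2 s : nat -> nat, increasing_seq s &
    exists c : I -> R, forall i, d (s n) i @[n --> \oo] --> c i.
Proof.
move=> dB.
suff [s si sc] : exists2 s : nat -> nat, increasing_seq s &
    forall i, i \in enum I -> exists c : R, d (s n) i @[n --> \oo] --> c.
  exists s => //.
  have /choice[c cP] : forall i, exists c : R, d (s n) i @[n --> \oo] --> c.
    by move=> i; apply: sc; rewrite mem_enum.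
  by exists c.
elim: (enum I) => [|i r [s si sc]]; first by exists id.
have [c [_ cc]] : exists c, (`[- B, B] `&` cluster (d (s n) i @[n --> \oo])) c.
  apply: (@segment_compact R (- B) B ((fun n => d (s n) i) @ \oo)).
  by exists 0%N => // n _; rewrite /= in_itv /= -ler_norml.
move/cluster_eventually_cvg : cc => [t ti tc].
exists (s \o t); first exact: increasing_seq_comp.
move=> j; rewrite inE => /predU1P[->|/sc [e ec]]; first by exists c.
by exists e; apply: (cvg_comp _ _ (increasing_seq_cvgn ti) ec).
Qed.

Lemma cvg_sgr_near (R : realType) (u : nat -> R) (a : R) : a != 0 ->
  u @ \oo --> a -> \forall n \near \oo, Num.sg (u n) = Num.sg a.
Proof.
move=> a0 ua; have na : 0 < `|a| by rewrite normr_gt0.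
near=> n.
have : `|a - u n| < `|a| by near: n; move/cvgrPdist_lt : ua; apply.
move=> h; case: (ltgtP a 0) a0 h => // ha _.
  rewrite (ltr0_norm ha) ltr_norml => /andP[h1 h2].
  by rewrite (ltr0_sg ha) ltr0_sg //; lra.
rewrite (gtr0_norm ha) ltr_norml => /andP[h1 h2].
by rewrite (gtr0_sg ha) gtr0_sg //; lra.
Unshelve. all: by end_near. Qed.

(* Induction on the support of [d]: after normalising by the largest coordinate
   and extracting a limit direction [c], the sign on [z] is decided by [c . z]
   unless it vanishes, in which case a multiple of [c] can be subtracted from
   [d n] so as to kill one coordinate. *)
Lemma sign_subsequence (R : realType) (I : finType) (d : nat -> I -> R) :
  exists2 s : nat -> nat, increasing_seq s &
    forall z : I -> R, exists e : R,
      \forall n \near \oo, Num.sg (\sum_i d (s n) i * z i) = e.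
Proof.
suff H m (A : {set I}) : (#|A| <= m)%N ->
    forall d : nat -> I -> R, (forall n i, i \notin A -> d n i = 0) ->
    exists2 s : nat -> nat, increasing_seq s &
    forall z : I -> R, exists e : R,
      \forall n \near \oo, Num.sg (\sum_i d (s n) i * z i) = e.
  by apply: (H #|I| [set: I]%SET) => [|n i]; rewrite ?cardsT// inE.
elim: m A => [|m IH] A Am {}d dA.
  exists id => // z; exists 0; apply: nearW => n; rewrite big1 ?sgr0// => i _.
  rewrite dA ?mul0r//; move: Am; rewrite leqn0 cards_eq0 => /eqP ->.
  by rewrite inE.
have [[i0 _]|nI] := pselect (exists i0 : I, true); last first.
  exists id => // z; exists 0; apply: nearW => n; rewrite big1 ?sgr0// => i _.
  by exfalso; apply: nI; exists i.
pose b n := [arg max_(i > i0) `|d n i|]%O.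
have bmax n i : `|d n i| <= `|d n (b n)|.
  by rewrite /b; case: arg_maxP => // j _; apply.
pose e n i := d n i / `|d n (b n)|.
have e1 n i : `|e n i| <= 1.
  rewrite /e normrM normfV normr_id; have [->|h] := eqVneq (`|d n (b n)|) 0.
    by rewrite invr0 mulr0.
  by rewrite ler_pdivrMr ?mul1r// lt_neqAle eq_sym h normr_ge0.
have [s si [c ec]] := bolzano_weierstrass_fin e1.
have de n i : d n i = `|d n (b n)| * e n i.
  rewrite /e mulrC; have [h|h] := eqVneq (`|d n (b n)|) 0; last by rewrite divfK.
  by rewrite h mulr0; apply/eqP; rewrite -normr_le0 -h.
have [[k k0]|c0] := pselect (exists k, c k != 0); last first.
  (* eventually no normalised coordinate has modulus one, which forces [d = 0] *)
  exists s => // z; exists 0.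
  have : \forall n \near \oo, forall i, `|e (s n) i| < 1.
    apply: filter_forall => i; have := ec i.
    have -> : c i = 0 by apply/eqP/negPn/negP => h; apply: c0; exists i.
    by move/cvgr0Pnorm_lt; apply.
  apply: filterS => n h; rewrite big1 ?sgr0// => i _; rewrite de.
  have := h (b (s n)); rewrite /e normrM normfV normr_id.
  have [->|h0] := eqVneq (`|d (s n) (b (s n))|) 0; first by rewrite !mul0r.
  by rewrite divff// ltxx.
have kA : k \in A.
  apply/negPn/negP => kA; case/negP: k0; apply/eqP.
  apply: (cvg_unique _ (ec k)) => //.
  have -> : (fun n => e (s n) k) = cst 0.
    by apply/funext => n; rewrite /e dA// mul0r.
  exact: cvg_cst.
pose d' n i := e (s n) i - e (s n) k / c k * c i.
have [|n i|t ti tP] := IH (A :\ k)%SET _ d'.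
- by move: Am; rewrite (cardsD1 k A) kA.
- rewrite in_setD1 negb_and negbK => /orP[/eqP ->|iA].
    by rewrite /d' divfK// subrr.
  rewrite /d' {1}/e dA// mul0r.
  have -> : c i = 0.
    apply: (cvg_unique _ (ec i)) => //.
    have -> : (fun n => e (s n) i) = cst 0.
      by apply/funext => n'; rewrite /e dA// mul0r.
    exact: cvg_cst.
  by rewrite mulr0 subr0.
(* The normalising factor has sign 0 or 1, so a further subsequence [u] makes this sign eventually
   constant. The sign on [d] is then that constant times the sign on [e]. *)
pose h n := Num.sg `|d (s (t n)) (b (s (t n)))|.
have h01 n : h n = 0 \/ h n = 1.
  rewrite /h sgr_norm; by case: eqP; [left|right].
have [u ui [y yP]] : exists2 u : nat -> nat, increasing_seq u &
    exists y, \forall n \near \oo, h (u n) = y.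
  have [|u ui [y yP]] := @bolzano_weierstrass_fin R unit (fun n _ => h n) 1.
    by move=> n _; case: (h01 n) => ->; rewrite ?normr0 ?normr1.
  exists u => //; have {}yP := yP tt.
  have [y0|y0] := eqVneq (y tt) 0.
    exists 0; move: yP; rewrite y0 => /cvgr0Pnorm_lt /(_ 1 ltr01).
    apply: filterS => n; case: (h01 (u n)) => -> //.
    by rewrite normr1 ltxx.
  exists (Num.sg (y tt)); move/(cvg_sgr_near y0) : yP; apply: filterS => n <-.
  by case: (h01 (u n)) => ->; rewrite ?sgr0 ?sgr1.
exists (s \o t \o u); first by do 2 apply: increasing_seq_comp.
move=> z.
have sgE n : Num.sg (\sum_i d n i * z i) =
    Num.sg `|d n (b n)| * Num.sg (\sum_i e n i * z i).
  rewrite -sgrM mulr_sumr; congr Num.sg; apply: eq_bigr => i _.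
  rewrite [in LHS]de; exact/esym/mulrA.
have [x xP] : exists x : R, \forall n \near \oo,
    Num.sg (\sum_i e (s (t (u n))) i * z i) = x.
  have tu := increasing_seq_cvgn (increasing_seq_comp ti ui).
  have [cz|cz] := eqVneq (\sum_i c i * z i) 0.
    have [x xP] := tP z; exists x.
    have xu : \forall n \near \oo, Num.sg (\sum_i d' (t (u n)) i * z i) = x.
      exact: (increasing_seq_cvgn ui xP).
    apply: filterS xu => n <-.
    congr Num.sg; rewrite /d'.
    under [in RHS]eq_bigr do rewrite mulrBl -[X in _ - X]mulrA.
    by rewrite sumrB -mulr_sumr cz mulr0 subr0.
  exists (Num.sg (\sum_i c i * z i)).
  have ez : (\sum_i e (s n) i * z i) @[n --> \oo] --> \sum_i c i * z i.
    by apply: cvg_sumr => i; apply: cvgMr_tmp; exact: ec.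
  exact: (tu _ (cvg_sgr_near cz ez)).
exists (y * x); move: yP xP; apply: filterS2 => n /= yn xn.
by rewrite sgE xn -yn.
Qed.

(** * Finite mixtures *)

Definition mixture (R : numDomainType) (Q : Type) (S : Q -> Prop) (n : nat)
    (p : 'I_n -> R) (s : 'I_n -> Q) :=
  [/\ forall j, 0 <= p j, \sum_j p j = 1 & forall j, S (s j)].

(** The combination is only asked to have equal coordinates, not zero ones. Together with zero total
    weight this is [k] linear equations rather than [k + 1], so [k + 1] points already suffice; this
    is why [M - 1] components remain in the end. *)
Lemma affine_dependence (R : fieldType) (k n : nat) (v : 'I_n -> 'I_k -> R) :
  (k < n)%N -> (0 < k)%N ->
  exists delta : 'I_n -> R, exists eta : R,
    [/\ exists j, delta j != 0, \sum_j delta j = 0 &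
        forall i, \sum_j delta j * v j i = eta].
Proof.
case: k v => // k v kn _.
pose A := \matrix_(j < n, i < k.+1) (if i == ord0 then 1 else v j i - v j ord0).
have : kermx A != 0.
  rewrite kermx_eq0 /row_free neq_ltn.
  by rewrite (leq_ltn_trans (rank_leq_col A)).
case/rowV0Pn => D /sub_kermxP DA D0.
have DA' i : \sum_j D 0 j * A j i = 0.
  by have := congr1 (fun M : 'M[R]_(1, k.+1) => M 0 i) DA; rewrite !mxE.
have sD : \sum_j D 0 j = 0.
  rewrite -[RHS](DA' ord0); apply: eq_bigr => j _.
  by rewrite mxE eqxx mulr1.
exists (D 0), (\sum_j D 0 j * v j ord0); split => // [|i].
  apply/existsP; apply: contraR D0 => /existsPn h.
  apply/eqP/rowP => j; rewrite mxE; apply/eqP/negPn; exact: h.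
have [->//|i0] := eqVneq i ord0.
apply/eqP; rewrite -subr_eq0 -sumrB -[X in _ == X](DA' i).
apply/eqP/eq_bigr => j _.
by rewrite mxE (negbTE i0) mulrBr.
Qed.

(* Moving the weights along an affine dependence changes all coordinates of the
   mean by the same nonnegative amount, until some weight vanishes. *)
Lemma mixture_drop (R : realFieldType) (Q : Type) (S : Q -> Prop) (k n : nat)
    (v : Q -> 'I_k -> R) (c : R) (p : 'I_n.+1 -> R) (s : 'I_n.+1 -> Q) :
  (0 < k <= n)%N -> mixture S p s ->
  (forall i, c <= \sum_j p j * v (s j) i) ->
  exists p' : 'I_n -> R, exists s' : 'I_n -> Q,
    mixture S p' s' /\ forall i, c <= \sum_j p' j * v (s' j) i.
Proof.
move=> /andP[k0 kn] [p0 p1 sS] cv.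
have [delta [eta [[j1 dj1] sd dv]]] :=
  @affine_dependence R k n.+1 (fun j => v (s j)) kn k0.
wlog eta0 : delta eta dj1 sd dv / 0 <= eta.
  move=> H; case: (lerP 0 eta) => [|eta0]; first exact: H dv.
  apply: (H (fun j => - delta j) (- eta)); first by rewrite oppr_eq0.
  - by rewrite sumrN sd oppr0.
  - by move=> i; rewrite -(dv i) -sumrN; apply: eq_bigr => j _; rewrite mulNr.
  - by rewrite oppr_ge0 ltW.
have [j2 dj2] : exists j, delta j < 0.
  apply/existsP; apply: contraNT dj1 => /existsPn h.
  have d0 j : 0 <= delta j by rewrite leNgt; exact: h.
  move/eqP: sd; rewrite psumr_eq0 => [|j _]; last exact: d0.
  by move/allP => /(_ j1); rewrite mem_index_enum; apply.
(* [F j] is the time at which the weight [p j + t * delta j] reaches zero; the smallest such time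
   removes component [j0] while the other weights stay nonnegative. *)
pose F j := p j / - delta j.
pose j0 := [arg min_(j < j2 | delta j < 0) F j]%O.
have [dj0 Fmin] : delta j0 < 0 /\ forall j, delta j < 0 -> F j0 <= F j.
  by rewrite /j0; case: arg_minP.
pose t := F j0.
have t0 : 0 <= t by rewrite /t /F divr_ge0 // oppr_ge0 ltW.
pose p' j := p j + t * delta j.
have p'j0 : p' j0 = 0.
  rewrite /p' /t /F invrN mulrN mulNr divfK ?subrr//.
  by rewrite lt_eqF.
have p'0 j : 0 <= p' j.
  rewrite /p'; case: (ltrP (delta j) 0) => dj; last first.
    by apply: addr_ge0; [exact: p0|exact: mulr_ge0].
  have := Fmin j dj; rewrite -/t {1}/F ler_pdivlMr ?oppr_gt0//.
  by rewrite mulrN -subr_ge0 opprK.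
exists (fun j => p' (lift j0 j)), (fun j => s (lift j0 j)).
have sE (g : 'I_n.+1 -> R) :
    \sum_j p' (lift j0 j) * g (lift j0 j) = \sum_j p' j * g j.
  by rewrite (bigD1_ord j0) //= p'j0 mul0r add0r.
split=> [|i].
  split => //.
  have := sE (fun=> 1); rewrite /= -!mulr_suml !mulr1.
  by move=> ->; rewrite big_split/= p1 -mulr_sumr sd mulr0 addr0.
rewrite (sE (fun j => v (s j) i)).
under eq_bigr do rewrite mulrDl -mulrA.
by rewrite big_split/= -mulr_sumr dv (le_trans (cv i)) // lerDl mulr_ge0.
Qed.

(** Components are dropped while there are more than [k]; once there are at most [k], copies of the
    first one with weight zero fill the free places. *)
Lemma mixture_resize (R : realFieldType) (Q : Type) (S : Q -> Prop) (k n : nat)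
    (v : Q -> 'I_k -> R) (c : R) (p : 'I_n -> R) (s : 'I_n -> Q) :
  (0 < k)%N -> mixture S p s ->
  (forall i, c <= \sum_j p j * v (s j) i) ->
  exists p' : 'I_k -> R, exists s' : 'I_k -> Q,
    mixture S p' s' /\ forall i, c <= \sum_j p' j * v (s' j) i.
Proof.
move=> k0; elim: n p s => [|n IH] p s mp cv.
  by case: mp => _; rewrite big_ord0 => /esym/eqP; rewrite oner_eq0.
have [kn|nk] := leqP k n.
  have [|p' [s' [mp' cv']]] := mixture_drop _ mp cv; first by rewrite k0.
  exact: IH mp' cv'.
pose q (i : 'I_k) : option 'I_n.+1 := insub (i : nat).
pose p' i := if q i is Some j then p j else 0.
pose s' i := if q i is Some j then s j else s ord0.
have sE (g : Q -> R) : \sum_i p' i * g (s' i) = \sum_j p j * g (s j).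
  pose F a := p (inord a) * g (s (inord a)).
  have -> : \sum_j p j * g (s j) = \sum_(j < n.+1) F j.
    by apply: eq_bigr => j _; rewrite /F inord_val.
  rewrite (big_ord_widen k F nk) [RHS]big_mkcond; apply: eq_bigr => i _ /=.
  rewrite /p' /s' /q; case: insubP => [j jn ji|/negbTE ->]; last by rewrite mul0r.
  by rewrite /F -ji inord_val ltn_ord.
case: mp => p0 p1 sS; exists p', s'; split => [|i].
  split=> [i||i].
  - by rewrite /p'; case: (q i).
  - have := sE (fun=> 1); rewrite /= -!mulr_suml !mulr1.
    by move=> ->.
  - by rewrite /s'; case: (q i).
by rewrite (sE (fun x => v x i)).
Qed.

Lemma mixture_extend (R : realFieldType) (Q : Type) (S : Q -> Prop) (n : nat)
    (p : 'I_n -> R) (s : 'I_n -> Q) (q : Q) (t : R) :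
  mixture S p s -> S q -> 0 <= t <= 1 ->
  exists p' : 'I_n.+1 -> R, exists s' : 'I_n.+1 -> Q, mixture S p' s' /\
    forall g : Q -> R,
      \sum_j p' j * g (s' j) = (1 - t) * (\sum_j p j * g (s j)) + t * g q.
Proof.
move=> [p0 p1 sS] Sq /andP[t0 t1].
pose p' j := if unlift ord0 j is Some i then (1 - t) * p i else t.
pose s' j := if unlift ord0 j is Some i then s i else q.
have pE (g : Q -> R) :
    \sum_j p' j * g (s' j) = (1 - t) * (\sum_j p j * g (s j)) + t * g q.
  rewrite big_ord_recl /p' /s' unlift_none addrC; congr (_ + _).
  by rewrite mulr_sumr; apply: eq_bigr => i _; rewrite liftK mulrA.
exists p', s'; split => //; split => [j||j].
- by rewrite /p'; case: unlift => // i; rewrite mulr_ge0 // subr_ge0.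
- have := pE (fun=> 1); rewrite /= -!mulr_suml !mulr1.
  by move=> ->; rewrite p1 !mulr1 subrK.
- by rewrite /s'; case: unlift.
Qed.

(** The left side is the squared distance from [x - y] to the nonpositive half-line, the right side
    its squared distance to the particular point min(0, x) of it. *)
Lemma sqr_max0B_le (R : realFieldType) (x y : R) :
  Num.max 0 (x - y) ^+ 2 <= (Num.max 0 x - y) ^+ 2.
Proof.
rewrite /Num.max; case: (ltP 0 x) => hx; case: (ltP 0 (x - y)) => hy;
  rewrite ?expr0n /= ?sqr_ge0//.
by nra.
Qed.

(* The excess below [c] is measured by the squared distance to the orthant
   [w >= c]; its gradient at a near-minimiser is a price vector, and the
   hypothesis yields a direction along which the distance still decreases. *)
Lemma mixture_minimax (R : realType) (Q : Type) (S : Q -> Prop) (k : nat)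
    (v : Q -> 'I_k -> R) (B c : R) :
  (forall q i, S q -> `|v q i| <= B) -> (exists q, S q) ->
  (forall (lam : 'I_k -> R) (eps : R), (forall i, 0 <= lam i) -> 0 < eps ->
    exists2 q, S q & c * (\sum_i lam i) - eps <= \sum_i lam i * v q i) ->
  forall eps : R, 0 < eps -> exists n, exists p : 'I_n -> R,
    exists s : 'I_n -> Q,
    mixture S p s /\ forall i, c - eps <= \sum_j p j * v (s j) i.
Proof.
move=> vB [q0 Sq0] cS eps eps0.
pose G (w : 'I_k -> R) := \sum_i Num.max 0 (c - w i) ^+ 2.
have G0 w : 0 <= G w by apply: sumr_ge0 => i _; exact: sqr_ge0.
pose mean n (p : 'I_n -> R) (s : 'I_n -> Q) i := \sum_j p j * v (s j) i.
pose E := [set x | exists n (p : 'I_n -> R) (s : 'I_n -> Q),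
  mixture S p s /\ x = G (mean n p s)].
have E_inf : has_inf E.
  split; last by exists 0 => _ [n [p [s [_ ->]]]].
  exists (G (mean 1%N (fun=> 1) (fun=> q0))); exists 1%N, (fun=> 1), (fun=> q0).
  by split => //; split => //; rewrite big_ord1.
set delta := inf E.
have d0 : 0 <= delta.
  by apply: lb_le_inf; [exact: E_inf.1|move=> _ [n [p [s [_ ->]]]]].
have [d_gt0|d_le0] := ltP 0 delta; last first.
  have [_ [n [p [s [mp ->]]]] Gw] := inf_adherent (exprn_gt0 2 eps0) E_inf.
  exists n, p, s; split => // i.
  move: Gw; rewrite /G (bigD1 i) //= -/delta.
  have : 0 <= \sum_(j < k | j != i) Num.max 0 (c - mean n p s j) ^+ 2.
    by apply: sumr_ge0 => j _; exact: sqr_ge0.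
  move: (\sum_(j < k | j != i) Num.max 0 (c - mean n p s j) ^+ 2) => r r0 Gw.
  rewrite -/(mean n p s i).
  have : Num.max 0 (c - mean n p s i) < eps.
    rewrite -(@ltr_pXn2r _ 2) ?nnegrE ?(ltW eps0)//; last by rewrite le_max lexx.
    by lra.
  by rewrite gt_max => /andP[_ h]; rewrite lerBlDr -lerBlDl ltW.
exfalso.
(* A step [t] towards [q] gains at least [t * delta] to first order and costs at most [t ^+ 2 * D]
   to second order. The choice of [t] makes this cost [t * delta / 2], and [G w] is taken within the
   same amount of the infimum. The summand [delta] makes [D] positive and keeps [t <= 1]. *)
pose D := k%:R * (2 * B) ^+ 2 + delta.
have D_gt0 : 0 < D by rewrite ltr_wpDl // mulr_ge0 ?sqr_ge0.
pose t := delta / (2 * D).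
have t01 : 0 <= t <= 1.
  rewrite divr_ge0 ?mulr_ge0 ?(ltW D_gt0)//= ler_pdivrMr ?mulr_gt0// mul1r.
  have dD : delta <= D by rewrite lerDr mulr_ge0 ?sqr_ge0.
  lra.
have tD : t * (2 * D) = delta by rewrite divfK // gt_eqF // mulr_gt0.
have t_gt0 : 0 < t by rewrite divr_gt0 // mulr_gt0.
have td_gt0 : 0 < t * delta / 2 by rewrite divr_gt0 // mulr_gt0.
have [_ [n [p [s [mp ->]]]] Gw] := inf_adherent td_gt0 E_inf.
set w := mean n p s in Gw.
pose lam i := Num.max 0 (c - w i).
have lam0 i : 0 <= lam i by rewrite le_max lexx.
have [q Sq hq] := cS lam (delta / 2) lam0 (divr_gt0 d_gt0 (ltr0n R 2)).
have [p' [s' [mp' mE]]] := mixture_extend mp Sq t01.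
have : delta <= G (mean _ p' s').
  by apply: ge_inf; [exact: E_inf.2|exists n.+1, p', s'].
apply/negP; rewrite -ltNge.
have wB i : `|w i| <= B.
  case: mp => p0 p1 sS; apply: le_trans (ler_norm_sum _ _ _) _.
  rewrite -[B]mul1r -p1 mulr_suml; apply: ler_sum => j _.
  by rewrite normrM (ger0_norm (p0 j)) ler_wpM2l // vB.
have lamE i : lam i * (c - w i) = lam i ^+ 2.
  rewrite /lam /Num.max; case: ltP => _; first by rewrite expr2.
  by rewrite mul0r expr0n.
(* [lam] paired with [c - w] gives [G w >= delta], and the price hypothesis at [q] loses only
   [delta / 2] of it. *)
have inner : delta / 2 <= \sum_i lam i * (v q i - w i).
  have gE : \sum_i lam i * (v q i - w i) =
      (\sum_i lam i * v q i) - c * (\sum_i lam i) + G w.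
    rewrite mulr_sumr /G -sumrB -big_split /=; apply: eq_bigr => i _.
    by rewrite -lamE /lam; ring.
  have dG : delta <= G w by apply: ge_inf; [exact: E_inf.2|exists n, p, s].
  lra.
have sq : \sum_i (v q i - w i) ^+ 2 <= k%:R * (2 * B) ^+ 2.
  rewrite mulr_natl -[k in _ *+ k]card_ord -sumr_const; apply: ler_sum => i _.
  rewrite -[X in X <= _]ger0_norm ?sqr_ge0// normrX ler_sqr ?nnegrE//.
    by rewrite (le_trans (ler_normB _ _))// mulr2n mulrDl mul1r lerD// vB.
  by rewrite mulr_ge0// (le_trans _ (wB i)).
have : G (mean _ p' s') <= \sum_i (lam i - t * (v q i - w i)) ^+ 2.
  apply: ler_sum => i _; rewrite /mean (mE (fun x => v x i)).
  rewrite -/(mean n p s i) -/w.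
  rewrite (_ : c - _ = c - w i - t * (v q i - w i)); last by ring.
  exact: sqr_max0B_le.
have -> : \sum_i (lam i - t * (v q i - w i)) ^+ 2 =
    G w - 2 * t * (\sum_i lam i * (v q i - w i)) +
    t ^+ 2 * (\sum_i (v q i - w i) ^+ 2).
  rewrite !mulr_sumr /G -sumrB -big_split /=; apply: eq_bigr => i _.
  by rewrite -/(lam i); ring.
have h1 : t * delta <= 2 * t * (\sum_i lam i * (v q i - w i)).
  by rewrite -mulrA mulrCA ler_pM2l //; lra.
have h2 : t ^+ 2 * (\sum_i (v q i - w i) ^+ 2) <= t ^+ 2 * D.
  by rewrite ler_wpM2l ?sqr_ge0// (le_trans sq)// lerDl.
have h3 : t ^+ 2 * D = t * delta / 2 by rewrite -tD expr2; field.
move=> h4; apply: (le_lt_trans h4); rewrite -/delta in Gw.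
lra.
Qed.

(** * Integration and measurability *)

Section RealIntegral.
Context (R : realType) (d : measure_display) (T : measurableType d).
Variable mu : {measure set T -> \bar R}.

Lemma integrable_patch (A : set T) (g : T -> R) : measurable A ->
  mu.-integrable setT (EFin \o g) -> mu.-integrable setT (EFin \o (g \_ A)).
Proof.
move=> mA ig; rewrite -restrict_EFin; apply/(integrable_mkcond _ mA).
by apply: integrableS ig.
Qed.

Lemma integrable_sumr (I : Type) (r : seq I) (g : I -> T -> R) :
  (forall i, mu.-integrable setT (EFin \o g i)) ->
  mu.-integrable setT (EFin \o (fun x => \sum_(i <- r) g i x)).
Proof.
move=> ig.
rewrite (_ : _ \o _ = fun x => (\sum_(i <- r) (EFin \o g i) x)%E).
  by apply: integrable_sum.
by apply/funext => x /=; rewrite sumEFin.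
Qed.

Lemma integrable_scaler (c : R) (g : T -> R) :
  mu.-integrable setT (EFin \o g) ->
  mu.-integrable setT (EFin \o (fun x => c * g x)).
Proof. by move=> ig; apply: (integrableZl _ c ig). Qed.

Lemma Rintegral_sum (I : Type) (r : seq I) (g : I -> T -> R) :
  (forall i, mu.-integrable setT (EFin \o g i)) ->
  \int[mu]_x (\sum_(i <- r) g i x) = \sum_(i <- r) \int[mu]_x g i x.
Proof.
move=> ig; elim: r => [|i r IH].
  rewrite big_nil; under eq_Rintegral do rewrite big_nil.
  by rewrite /Rintegral integral0.
rewrite big_cons -IH -RintegralD//; last exact: integrable_sumr.
by apply: eq_Rintegral => x _; rewrite big_cons.
Qed.

Lemma Rintegral_eq0_ae (g : T -> R) (A : set T) : measurable A ->
  (forall x, 0 <= g x) -> mu.-integrable setT (EFin \o g) ->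
  \int[mu]_(x in A) g x = 0 <-> {ae mu, forall x, A x -> g x = 0}.
Proof.
move=> mA g0 ig.
have igA : mu.-integrable A (EFin \o g) by apply: integrableS ig.
have fing := integrable_fin_num mA igA.
have mg : measurable_fun A (EFin \o g) by case/integrableP : igA.
have gE : (\int[mu]_(x in A) `|(EFin \o g) x| = \int[mu]_(x in A) (g x)%:E)%E.
  by apply: eq_integral => x _ /=; rewrite ger0_norm.
have [h1 h2] := ae_eq_integral_abs mu mA mg.
split.
  move=> int0; have /h1 : (\int[mu]_(x in A) `|(EFin \o g) x| = 0)%E.
    by rewrite gE -(fineK fing) -[fine _]/(\int[mu]_(x in A) g x) int0.
  by apply: filterS => x h Ax; have [] := h Ax.
move=> h; rewrite /Rintegral -gE h2 //.
by apply: filterS h => x h Ax /=; rewrite h.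
Qed.

(* If each point of the support of [g] lies in at most [N] of the sets [A t],
   then at most [N * n * \int g] of them can carry an integral above [1 / n]. *)
Lemma countable_bounded_overlap (g : T -> R) (A : R -> set T) (N : nat) :
  (forall x, 0 <= g x) -> mu.-integrable setT (EFin \o g) ->
  (forall t, measurable (A t)) ->
  (forall x (ts : seq R), g x != 0 -> uniq ts -> (forall t, t \in ts -> A t x) ->
     (size ts <= N)%N) ->
  countable [set t | \int[mu]_(x in A t) g x != 0].
Proof.
move=> g0 ig mA AN.
have A0 t : 0 <= \int[mu]_(x in A t) g x by apply: Rintegral_ge0.
pose C n := [set t | n.+1%:R^-1 <= \int[mu]_(x in A t) g x].
apply: (@sub_countable _ _ _ (\bigcup_n C n)).
  apply: subset_card_le => t /= t0.
  have tpos : 0 < \int[mu]_(x in A t) g x by rewrite lt_neqAle eq_sym t0 A0.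
  exists (Num.truncn (\int[mu]_(x in A t) g x)^-1) => //=.
  by rewrite /C /= invf_ple ?posrE ?ltr0n// ltW // truncnS_gt.
apply: bigcup_countable => // n _; apply: finite_set_countable.
apply: contrapT => /infinite_set_fset infC.
pose G := \int[mu]_x g x.
(* So many members of [C n], each carrying at least [1 / n.+1], exceed the overlap bound [N * G]. *)
have [B BC sB] := infC (Num.truncn (n.+1%:R * (N%:R * G))).+1.
set ts := finmap.enum_fset B in sB.
have uts : uniq ts by exact: finmap.fset_uniq.
have low : (size ts)%:R / n.+1%:R <= \sum_(t <- ts) \int[mu]_(x in A t) g x.
  rewrite (_ : _ / _ = \sum_(t <- ts) n.+1%:R^-1).
    rewrite big_seq [leRHS]big_seq; apply: ler_sum => t tB; exact: BC.
  by rewrite big_const_seq count_predT iter_addr_0 mulr_natl.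
have up : \sum_(t <- ts) \int[mu]_(x in A t) g x <= N%:R * G.
  under eq_bigr do rewrite Rintegral_mkcond.
  rewrite -Rintegral_sum; last by move=> t; exact: integrable_patch.
  rewrite -RintegralZl//; apply: le_Rintegral => //.
  - by apply: integrable_sumr => t; exact: integrable_patch.
  - exact: integrable_scaler.
  move=> x _; have [gx|gx] := eqVneq (g x) 0.
    by rewrite gx mulr0 big1 // => t _; rewrite patchE; case: ifP.
  under eq_bigr do rewrite patchE.
  rewrite -big_mkcond /= big_const_seq iter_addr_0 -[leLHS]mulr_natl /= ler_wpM2r//.
  rewrite ler_nat -size_filter; apply: (AN x) => //; first exact: filter_uniq.
  by move=> t; rewrite mem_filter => /andP[/set_mem].
have := le_trans low up; rewrite ler_pdivrMr ?ltr0n// mulrC leNgt => /negP; apply.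
apply: lt_le_trans (truncnS_gt _) _; by rewrite ler_nat.
Qed.

(** Otherwise the interval would be countable, hence Lebesgue null. *)
Lemma exists_notin_countable (C : set R) (e : R) : countable C -> 0 < e ->
  exists2 t, 0 < t < e & ~ C t.
Proof.
move=> cC e0; apply: contrapT => H.
have sub : `]0, e[%classic `<=` C.
  move=> t; rewrite /= in_itv /= => te; apply: contrapT => nC.
  by apply: H; exists t.
have := countable_lebesgue_measure0 (sub_countable (subset_card_le sub) cC).
rewrite lebesgue_measure_itv /= lte_fin e0 => /eqP.
by rewrite sube0 eqe gt_eqF.
Qed.

End RealIntegral.

Lemma nneseries_insub (R : realType) (k : nat) (g : 'I_k -> R) :
  (\sum_(j <oo) (if insub j is Some i then g i else 0)%:E = (\sum_i g i)%:E)%E.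
Proof.
pose G (j : nat) : R := if insub j is Some i then g i else 0.
apply: lim_near_cst => //; exists k => // n /= kn.
rewrite sumEFin big_mkord; congr EFin.
transitivity (\sum_(i < k) G i).
  rewrite (big_ord_widen n G kn) [RHS]big_mkcond; apply: eq_bigr => i _ /=.
  by rewrite /G; case: insubP => [j -> _ //|/negbTE ->].
by apply: eq_bigr => i _; rewrite /G valK.
Qed.

(** Only which of the finitely many sets [B v] contain the point matters, so every fibre is a finite
    union of atoms of these sets. *)
Lemma quantizer_select (d : measure_display)
    (T : measurableType d) (l : nat) (B : 'I_l -> set T)
    (F : {set 'I_l} -> 'I_l) : (forall u, measurable (B u)) ->
  is_quantizer (fun x => F (finset (fun u => x \in B u))).
Proof.
move=> mB u.
rewrite (_ : _ @^-1` _ = \bigcup_(s in [set s | F s = u])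
    \bigcap_(v in [set: 'I_l]) (if v \in s then B v else ~` B v)).
  apply: fin_bigcup_measurable => [|s _]; first exact: finite_finset.
  apply: fin_bigcap_measurable => [|v _]; first exact: finite_finset.
  by case: ifP => _ //; exact: measurableC.
apply/seteqP; split => [x /= Fx|x [s /= Fs sx]].
  exists (finset (fun u => x \in B u)) => // v _.
  by rewrite finset.inE; case: ifPn => [/set_mem//|/negP h /mem_set].
rewrite -Fs; congr F; apply/finset.setP => v; rewrite finset.inE.
have := sx v I; case: ifPn => vs h; first by rewrite mem_set.
by apply/negP => /set_mem.
Qed.

(** * Informations of quantizers *)

Definition kl_term (R : realType) (x y : R) : R :=
  if x == 0 then 0 else x * ln (x / y).

(** The slope at which the bound [kl_term_ge] is attained. The value 1 at [x = 0] keeps it positive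
    where both arguments vanish. *)
Definition kl_ratio (R : realType) (x y : R) : R := if x == 0 then 1 else x / y.

(** The left side is the tangent plane, along the ray [x = r * y], of the convex and positively
    homogeneous function [x * ln (x / y)]. The bound reduces to [ln z <= z - 1] at
    [z = y * r / x]. *)
Lemma kl_term_ge (R : realType) (x y r : R) :
  0 <= x -> 0 <= y -> (y = 0 -> x = 0) -> 0 < r ->
  x * (ln r + 1) - y * r <= kl_term x y.
Proof.
move=> x0 y0 yx r0; rewrite /kl_term; case: eqVneq => [->|xn0].
  by rewrite mul0r sub0r oppr_le0 mulr_ge0 // ltW.
have xp : 0 < x by rewrite lt_neqAle eq_sym xn0.
have yp : 0 < y.
  by rewrite lt_neqAle y0 andbT eq_sym; apply: contra_neq xn0; exact: yx.
pose z := y * r / x.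
have zp : 0 < z by rewrite divr_gt0 // mulr_gt0.
have -> : x / y = r / z by rewrite /z; field; rewrite !gt_eqF.
rewrite ln_div ?posrE // -(_ : x * z = y * r); last first.
  by rewrite /z mulrC divfK.
have : ln (1 + (z - 1)) <= z - 1 by apply: le_ln1Dx; lra.
rewrite (_ : 1 + (z - 1) = z); last by ring.
move=> lz; rewrite -subr_ge0.
rewrite (_ : _ - _ = x * (z - 1 - ln z)); last by ring.
by rewrite mulr_ge0 // subr_ge0.
Qed.

Lemma kl_ratio_gt0 (R : realType) (x y : R) :
  0 <= x -> 0 <= y -> (y = 0 -> x = 0) -> 0 < kl_ratio x y.
Proof.
move=> x0 y0 yx; rewrite /kl_ratio; case: eqVneq => [//|xn0].
rewrite divr_gt0 // lt_neqAle ?x0 ?y0 eq_sym ?xn0 // andbT.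
by apply: contra_neq xn0; exact: yx.
Qed.

Lemma kl_term_ratio (R : realType) (x y : R) : (y = 0 <-> x = 0) ->
  kl_term x y = x * (ln (kl_ratio x y) + 1) - y * kl_ratio x y.
Proof.
move=> yx; rewrite /kl_term /kl_ratio; case: eqVneq => [x0|xn0].
  by rewrite x0 yx.2 // !mul0r subr0.
have yn0 : y != 0 by apply: contra_neq xn0; exact: yx.1.
by rewrite [y * _]mulrC divfK // mulrDr mulr1 addrK.
Qed.

(** * Cell probabilities as integrals of scores *)

Section Densities.
Context (R : realType) (d : measure_display) (T : measurableType d).
Variables (mu : {measure set T -> \bar R}) (M l : nat) (f : 'I_M -> T -> R).
Hypothesis hfmeas : forall m, measurable_fun setT (f m).
Hypothesis hfge0 : forall m x, 0 <= f m x.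
Hypothesis hfprob : forall m, (\int[mu]_x (f m x)%:E)%E = 1%E.

Lemma integrable_density m : mu.-integrable setT (EFin \o f m).
Proof.
apply/integrableP; split; first exact/measurable_EFinP.
rewrite (_ : (\int[mu]_x _)%E = 1%E) ?ltry // -(hfprob m).
by apply: eq_integral => x _ /=; rewrite ger0_norm.
Qed.
Hint Resolve integrable_density : core.

Lemma fq_ge0 m (phi : T -> 'I_l) u : 0 <= fq mu f m phi u.
Proof. by apply: Rintegral_ge0. Qed.

(** On each cell the chosen score is a fixed combination of densities. A linear form in the cell
    probabilities thus becomes an integral, which can be optimised pointwise. *)
Lemma integrable_lscore (a : 'I_l -> 'I_M -> R) (phi : T -> 'I_l) :
  is_quantizer phi ->
  mu.-integrable setT (EFin \o (fun x => lscore f a (phi x) x)) /\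
  \int[mu]_x lscore f a (phi x) x = \sum_u \sum_m a u m * fq mu f m phi u.
Proof.
move=> qphi.
have E x : lscore f a (phi x) x =
    \sum_u \sum_m a u m * (f m \_ (phi @^-1` [set u])) x.
  rewrite (bigD1 (phi x)) //= [X in _ + X]big1 ?addr0; last first.
    move=> u ux; rewrite big1 // => m _; rewrite patchE memNset ?mulr0 //=.
    by move=> e; rewrite e eqxx in ux.
  by apply: eq_bigr => m _; rewrite patchE mem_set.
have int1 u m : mu.-integrable setT
    (EFin \o (fun x => a u m * (f m \_ (phi @^-1` [set u])) x)).
  by apply: integrable_scaler; exact: integrable_patch.
have int2 u : mu.-integrable setT
    (EFin \o (fun x => \sum_m a u m * (f m \_ (phi @^-1` [set u])) x)).
  exact: integrable_sumr.
split.
  rewrite (_ : _ \o _ = EFin \o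
    (fun x => \sum_u \sum_m a u m * (f m \_ (phi @^-1` [set u])) x)).
    exact: integrable_sumr.
  by apply/funext => x /=; rewrite E.
under eq_Rintegral do rewrite E.
rewrite Rintegral_sum //; apply: eq_bigr => u _.
rewrite Rintegral_sum //; apply: eq_bigr => m _.
by rewrite RintegralZl //; [rewrite -Rintegral_mkcond|exact: integrable_patch].
Qed.

Lemma fq_sum1 m (phi : T -> 'I_l) : is_quantizer phi ->
  \sum_u fq mu f m phi u = 1.
Proof.
move=> qphi; have [_] := integrable_lscore (fun _ m' => (m' == m)%:R) qphi.
have sE (g : 'I_M -> R) : \sum_m' (m' == m)%:R * g m' = g m.
  rewrite (bigD1 m) //= eqxx mul1r big1 ?addr0 // => m' /negbTE ->.
  by rewrite mul0r.
under [RHS]eq_bigr do rewrite sE.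
move=> <-; transitivity (\int[mu]_x f m x).
  by apply: eq_Rintegral => x _; rewrite /lscore (sE (f ^~ x)).
by rewrite /Rintegral hfprob.
Qed.

Lemma fq_le1 m (phi : T -> 'I_l) u : is_quantizer phi -> fq mu f m phi u <= 1.
Proof.
move=> qphi; rewrite -(fq_sum1 m qphi) (bigD1 u) //= lerDl.
by apply: sumr_ge0 => v _; exact: fq_ge0.
Qed.

Lemma lscore_argmin_opt (a : 'I_l -> 'I_M -> R) (phi phi' : T -> 'I_l) :
  is_quantizer phi -> is_quantizer phi' ->
  (forall x k, lscore f a (phi' x) x <= lscore f a k x) ->
  \sum_u \sum_m a u m * fq mu f m phi' u <=
  \sum_u \sum_m a u m * fq mu f m phi u.
Proof.
move=> qphi qphi' opt.
have [i1 <-] := integrable_lscore a qphi.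
have [i2 <-] := integrable_lscore a qphi'.
by apply: le_Rintegral.
Qed.

(** * Measurability of score comparisons, and null ties *)

Lemma measurable_lscore (a : 'I_l -> 'I_M -> R) u :
  measurable_fun setT (lscore f a u).
Proof.
by apply: measurable_sum => m; apply: measurable_funM.
Qed.

Lemma measurable_lscore_eq (a : 'I_l -> 'I_M -> R) u v :
  measurable [set x | lscore f a u x = lscore f a v x].
Proof.
have := measurable_fun_eqr (measurable_lscore a u) (measurable_lscore a v).
move=> /(_ measurableT [set true] I); rewrite setTI.
by congr measurable; apply/seteqP; split => x /= /eqP.
Qed.

Lemma measurable_lscore_le (a : 'I_l -> 'I_M -> R) u v :
  measurable [set x | lscore f a u x <= lscore f a v x].
Proof.
have := measurable_fun_ler (measurable_lscore a u) (measurable_lscore a v).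
by move=> /(_ measurableT [set true] I); rewrite setTI.
Qed.

Lemma measurable_lscore_min (a : 'I_l -> 'I_M -> R) u :
  measurable [set x | forall k, lscore f a u x <= lscore f a k x].
Proof.
rewrite (_ : [set x | _] =
    \bigcap_(k in [set: 'I_l]) [set x | lscore f a u x <= lscore f a k x]).
  apply: fin_bigcap_measurable => [|k _]; first exact: finite_finset.
  exact: measurable_lscore_le.
by apply/seteqP; split => x /= h k; [move=> _; exact: h|exact: h].
Qed.

Lemma argmin_quantizer (a : 'I_l -> 'I_M -> R) : (0 < l)%N ->
  exists2 phi : T -> 'I_l, is_quantizer phi &
    forall x k, lscore f a (phi x) x <= lscore f a k x.
Proof.
move=> l0; pose u0 := Ordinal l0.
pose B u := [set x | forall k, lscore f a u x <= lscore f a k x].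
pose F (s : {set 'I_l}) := odflt u0 [pick u in s].
exists (fun x => F (finset (fun u => x \in B u))).
  apply: quantizer_select => u; exact: measurable_lscore_min.
move=> x k; rewrite /F; case: pickP => [u|].
  by rewrite finset.inE => /set_mem; apply.
pose u := [arg min_(v < u0) lscore f a v x]%O.
move=> /(_ u); rewrite finset.inE => /negbT/negP[]; apply/mem_set => v.
by rewrite /u; case: arg_minP => // w _; apply.
Qed.

Lemma measurable_tie_set (a : 'I_l -> 'I_M -> R) : measurable (tie_set f a).
Proof.
rewrite (_ : tie_set f a = \bigcup_(p in [set p : 'I_l * 'I_l | p.1 != p.2])
    ([set x | lscore f a p.1 x = lscore f a p.2 x] `&`
     [set x | forall k, lscore f a p.1 x <= lscore f a k x])).
  apply: fin_bigcup_measurable => [|p _]; first exact: finite_finset.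
  apply: measurableI; first exact: measurable_lscore_eq.
  exact: measurable_lscore_min.
apply/seteqP; split => [x [i [j [ij [e h]]]]|x [[i j] /= ij [e h]]].
  by exists (i, j).
by exists i, j.
Qed.

Lemma tie_set_null (a : 'I_l -> 'I_M -> R) m :
  (forall u v : 'I_l, u != v ->
    \int[mu]_(x in [set x | lscore f a u x = lscore f a v x]) f m x = 0) ->
  (\int[mu]_(x in tie_set f a) (f m x)%:E = 0)%E.
Proof.
move=> h; have mt := measurable_tie_set a.
have itie : mu.-integrable (tie_set f a) (EFin \o f m).
  by apply: integrableS (integrable_density m).
rewrite -(fineK (integrable_fin_num mt itie)); congr EFin.
apply/Rintegral_eq0_ae => //.
have : {ae mu, forall x (p : 'I_l * 'I_l), p.1 != p.2 ->
    lscore f a p.1 x = lscore f a p.2 x -> f m x = 0}.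
  apply: filter_forall => p; have [pp|pp] := eqVneq p.1 p.2.
    by apply: nearW => x.
  have := h _ _ pp; move/(Rintegral_eq0_ae (measurable_lscore_eq a _ _)).
  move=> /(_ (hfge0 m) (integrable_density m)); apply: filterS => x hx _.
  exact: hx.
by apply: filterS => x hx [i [j [ij [e _]]]]; apply: (hx (i, j)).
Qed.

(* Adding a monomial in [t], of a different degree for each coefficient, makes
   two scores agree at a given point for only finitely many [t]. *)
Definition perturbed (g : 'I_l -> 'I_M -> R) (t : R) (u : 'I_l) (m : 'I_M) : R :=
  - g u m + t ^+ (u * M + m).+1.

Lemma countable_ties (g : 'I_l -> 'I_M -> R) (m : 'I_M) (u v : 'I_l) : u != v ->
  countable [set t | \int[mu]_(x in
    [set x | lscore f (perturbed g t) u x = lscore f (perturbed g t) v x]) f m x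
    != 0].
Proof.
move=> uv; apply: (countable_bounded_overlap (N := l * M)) => //.
  by move=> t; exact: measurable_lscore_eq.
move=> x ts fx uts tie.
(* Since [n < M], division by [M] recovers [w] and [n] from the exponent; the successor keeps the
   monomials away from the constant term. *)
pose e (w : 'I_l) (n : 'I_M) := (w * M + n).+1.
have e_inj w w' n n' : e w n = e w' n' -> w = w' /\ n = n'.
  case=> h; have M0 : (0 < M)%N by apply: leq_ltn_trans (ltn_ord n).
  have hd := congr1 (divn^~ M) h; have hm := congr1 (modn^~ M) h.
  rewrite /= !divnMDl // !divn_small // !addn0 in hd.
  rewrite /= !modnMDl !modn_small // in hm.
  by split; apply: val_inj.
have eM w n : (e w n <= l * M)%N.
  rewrite /e; apply: (@leq_trans (w.+1 * M)); last by rewrite leq_mul2r ltn_ord orbT.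
  by rewrite mulSn addnC ltn_add2r.
(* [P] vanishes at [t] exactly when the scores of [u] and [v] agree at [x]. Its coefficient of
   degree [e u m] is [f m x], which is nonzero, and its degree is at most [l * M]; this bounds the
   number of such [t]. *)
pose P : {poly R} := \sum_n f n x *:
  ((g v n - g u n)%:P + 'X^(e u n) - 'X^(e v n)).
have PE t : P.[t] = lscore f (perturbed g t) u x - lscore f (perturbed g t) v x.
  rewrite horner_sum /lscore -sumrB; apply: eq_bigr => n _.
  by rewrite !hornerE /perturbed /e; ring.
have P0 : P != 0.
  apply: contraNneq fx => P0.
  have := congr1 (fun p : {poly R} => p`_(e u m)) P0.
  rewrite coef0 coef_sum (bigD1 m) //= big1 ?addr0; last first.
    move=> n nm; rewrite coefZ !coefE /=.
    have -> : (e u m == e u n) = false.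
      by apply/eqP => /e_inj[_ mn]; rewrite mn eqxx in nm.
    have -> : (e u m == e v n) = false.
      by apply/eqP => /e_inj[uv' _]; rewrite uv' eqxx in uv.
    by rewrite addr0 subr0 mulr0.
  rewrite coefZ !coefE eqxx /=.
  have -> : (e u m == e v m) = false.
    by apply/eqP => /e_inj[uv' _]; rewrite uv' eqxx in uv.
  by rewrite add0r subr0 mulr1 => ->.
have szP : (size P <= (l * M).+1)%N.
  apply/leq_sizeP => j lj; rewrite coef_sum big1 // => n _.
  have je w : (j == e w n) = false by rewrite gtn_eqF // (leq_ltn_trans (eM w n)).
  rewrite coefZ !coefE !je.
  by case: j lj {je} => //= j _; rewrite addr0 subr0 mulr0.
rewrite -ltnS; apply: leq_trans szP; apply: max_poly_roots => //.
apply/allP => t /tie /= tt; apply/rootP.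
by rewrite PE tt subrr.
Qed.

(** The scores are [- g] plus small monomials, so their argmin maximises the form of [g] up to the
    size of the perturbation; a value of [t] outside a countable set makes all ties null. *)
Lemma ULQ_approx (g : 'I_l -> 'I_M -> R) (phi : T -> 'I_l) (eps : R) :
  (0 < l)%N -> is_quantizer phi -> 0 < eps ->
  exists2 phi' : T -> 'I_l, is_ULQ mu f phi' &
    \sum_u \sum_m g u m * fq mu f m phi u - eps <=
    \sum_u \sum_m g u m * fq mu f m phi' u.
Proof.
move=> l0 qphi eps0.
pose bad (q : 'I_l * 'I_l * 'I_M) := [set t | q.1.1 != q.1.2 /\ \int[mu]_(x in
    [set x | lscore f (perturbed g t) q.1.1 x = lscore f (perturbed g t) q.1.2 x])
    f q.2 x != 0].
have cbad : countable (\bigcup_(q in setT) bad q).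
  apply: bigcup_countable => [|[[u v] m] _].
    by apply: finite_set_countable; exact: finite_finset.
  have [uv|uv] := eqVneq u v.
    by apply: (sub_countable (B := set0)) => //; apply: subset_card_le => t [] /=;
      rewrite uv eqxx.
  apply: sub_countable (countable_ties g m uv).
  by apply: subset_card_le => t [].
(* The perturbation has [l * M] terms, each at most [t], so [t * K <= eps] controls it; the extra 1
   keeps [K] positive. *)
pose K : R := (l * M)%:R + 1.
have K0 : 0 < K by rewrite ltr_wpDl.
have [|t /andP[t0 tlt] nbad] := @exists_notin_countable R _
    (Num.min 1 (eps / K)) cbad.
  by rewrite lt_min ltr01 divr_gt0.
have /andP[t1 teps] : (t < 1) && (t < eps / K) by rewrite -lt_min.
have [phi' qphi' opt] := argmin_quantizer (perturbed g t) l0.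
exists phi'.
  split => //; exists (perturbed g t); split => // m.
  apply: tie_set_null => u v uv; apply/eqP/negPn/negP => h.
  by apply: nbad; exists (u, v, m).
pose pert (psi : T -> 'I_l) :=
  \sum_(u < l) \sum_(m < M) t ^+ (u * M + m).+1 * fq mu f m psi u.
have pE psi : \sum_u \sum_m perturbed g t u m * fq mu f m psi u =
    pert psi - \sum_u \sum_m g u m * fq mu f m psi u.
  rewrite -sumrB; apply: eq_bigr => u _; rewrite -sumrB; apply: eq_bigr => m _.
  by rewrite /perturbed; ring.
have := lscore_argmin_opt qphi qphi' opt; rewrite !pE.
have p0 : 0 <= pert phi'.
  apply: sumr_ge0 => u _; apply: sumr_ge0 => m _.
  by rewrite mulr_ge0 ?fq_ge0 // exprn_ge0 // ltW.
have p1 : pert phi <= eps.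
  apply: (@le_trans _ _ (t * K)); last by rewrite -ler_pdivlMr // ltW.
  apply: (@le_trans _ _ (\sum_(u < l) \sum_(m < M) t)).
    apply: ler_sum => u _; apply: ler_sum => m _.
    rewrite -[leRHS]mulr1 ler_pM ?fq_ge0 ?fq_le1 // ?exprn_ge0 ?(ltW t0) //.
    by rewrite exprS ler_piMr ?(ltW t0) // exprn_ile1 ?ltW.
  rewrite !sumr_const !card_ord -mulrnA mulrDr mulr1 mulr_natr mulnC lerDl.
  exact: ltW.
lra.
Qed.

(** * Absolute continuity and bounds on the informations *)

Hypothesis hkl : forall m m' : 'I_M, m != m' ->
  mu.-integrable setT (kl_integrand f m m').

(** [kl_integrand] is infinite exactly where [f m] is nonzero and [f m'] vanishes; being integrable,
    it is finite almost everywhere. *)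
Lemma Rintegral_ac (m m' : 'I_M) (A : set T) : m != m' -> measurable A ->
  \int[mu]_(x in A) f m' x = 0 -> \int[mu]_(x in A) f m x = 0.
Proof.
move=> mm' mA; have ik m0 := integrable_density m0.
move=> /(Rintegral_eq0_ae mA (hfge0 m') (ik m')) h.
apply/(Rintegral_eq0_ae mA (hfge0 m) (ik m)).
move: (integrable_ae measurableT (hkl mm')) h; apply: filterS2 => x kx hx Ax.
apply/eqP/negPn/negP => fx; have := kx I.
by rewrite /kl_integrand (negbTE fx) hx // eqxx.
Qed.

Lemma fq_ac (m m' : 'I_M) (phi : T -> 'I_l) u : is_quantizer phi -> m != m' ->
  fq mu f m' phi u = 0 <-> fq mu f m phi u = 0.
Proof.
by move=> qphi mm'; split; apply: Rintegral_ac => //; rewrite eq_sym.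
Qed.

(** This is the log-sum inequality: the pointwise bound [kl_term_ge], taken at the ratio of the two
    integrals over [A], is integrated over [A]. *)
Lemma kl_term_le (m m' : 'I_M) (A : set T) : m != m' -> measurable A ->
  kl_term (\int[mu]_(x in A) f m x) (\int[mu]_(x in A) f m' x) <=
  fine (\int[mu]_(x in A) kl_integrand f m m' x)%E.
Proof.
move=> mm' mA.
set a := \int[mu]_(x in A) f m x; set b := \int[mu]_(x in A) f m' x.
have ba : b = 0 <-> a = 0 by split; apply: Rintegral_ac => //; rewrite eq_sym.
pose r := kl_ratio a b.
have r0 : 0 < r by apply: kl_ratio_gt0; [exact: Rintegral_ge0|exact: Rintegral_ge0|apply ba].
have im n : mu.-integrable A (EFin \o f n).
  by apply: integrableS (integrable_density n).
have imZ n (c : R) : mu.-integrable A (EFin \o (fun x => f n x * c)).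
  rewrite (_ : _ \o _ = fun x => (c%:E * (EFin \o f n) x)%E).
    by apply: integrableZl.
  by apply/funext => x /=; rewrite mulrC.
have iL : mu.-integrable A (EFin \o (fun x => f m x * (ln r + 1) - f m' x * r)).
  exact: (integrableB mA (imZ m _) (imZ m' _)).
have ik : mu.-integrable A (kl_integrand f m m') by apply: integrableS (hkl mm').
rewrite kl_term_ratio // -/r -/a -/b /a /b -!RintegralZr //.
rewrite -RintegralB //; apply: fine_le.
- exact: integrable_fin_num iL.
- exact: integrable_fin_num ik.
apply: le_integral => // x _; rewrite /kl_integrand.
have [fx|fx] := eqVneq (f m x) 0.
  by rewrite lee_fin fx mul0r sub0r oppr_le0 mulr_ge0 // ltW.
have [fx'|fx'] := eqVneq (f m' x) 0; first by rewrite leey.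
rewrite lee_fin; apply: le_trans (kl_term_ge (hfge0 m x) (hfge0 m' x) _ r0) _.
  by move=> h; rewrite h eqxx in fx'.
by rewrite /kl_term (negbTE fx).
Qed.

(** The indices [lift m i] run over the states other than [m]. The coefficients [g] add up the
    tangent planes of all cell terms at [phi], weighted by the prices; convexity puts them below the
    informations of any other quantizer. *)
Lemma Idet_linear_le (lam : 'I_M.-1 -> R) (m : 'I_M) (phi : T -> 'I_l) :
  (forall i, 0 <= lam i) -> is_quantizer phi ->
  exists g : 'I_l -> 'I_M -> R,
    \sum_u \sum_n g u n * fq mu f n phi u =
      \sum_i lam i * Idet mu f m (lift m i) phi /\
    forall psi, is_quantizer psi ->
      \sum_u \sum_n g u n * fq mu f n psi u <=
      \sum_i lam i * Idet mu f m (lift m i) psi.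
Proof.
move=> lam0 qphi.
pose r i u := kl_ratio (fq mu f m phi u) (fq mu f (lift m i) phi u).
have r0 i u : 0 < r i u.
  apply: kl_ratio_gt0; rewrite ?fq_ge0 //.
  exact: (fq_ac u qphi (neq_lift m i)).1.
pose g u n := \sum_i lam i *
  ((n == m)%:R * (ln (r i u) + 1) - (n == lift m i)%:R * r i u).
have pick1 (G : 'I_M -> R) (n0 : 'I_M) : \sum_n (n == n0)%:R * G n = G n0.
  rewrite (bigD1 n0) //= eqxx mul1r big1 ?addr0 // => n /negbTE ->.
  by rewrite mul0r.
have gE psi : \sum_u \sum_n g u n * fq mu f n psi u = \sum_i lam i *
    \sum_u (fq mu f m psi u * (ln (r i u) + 1) - fq mu f (lift m i) psi u * r i u).
  under [RHS]eq_bigr do rewrite mulr_sumr.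
  rewrite [RHS]exchange_big /=; apply: eq_bigr => u _.
  under eq_bigr do rewrite mulr_suml.
  rewrite exchange_big /=; apply: eq_bigr => i _.
  rewrite -(pick1 (fun n => fq mu f n psi u * (ln (r i u) + 1)) m).
  rewrite -(pick1 (fun n => fq mu f n psi u * r i u) (lift m i)).
  rewrite -sumrB mulr_sumr; apply: eq_bigr => n _; ring.
exists g; split => [|psi qpsi]; rewrite gE.
  apply: eq_bigr => i _; congr (_ * _); apply: eq_bigr => u _.
  rewrite -kl_term_ratio //.
  exact: fq_ac qphi (neq_lift m i).
apply: ler_sum => i _; apply: ler_wpM2l => //; apply: ler_sum => u _.
apply: kl_term_ge; rewrite ?fq_ge0 //.
exact: (fq_ac u qpsi (neq_lift m i)).1.
Qed.

(** The tangent bound with slope 1 gives nonnegativity, since both families of cell probabilities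
    sum to one. From above, each cell term is at most the integral of the absolute divergence
    integrand; summing over [i] makes the bound uniform in the state. *)
Lemma Idet_bounded (m : 'I_M) : exists B : R, forall i (phi : T -> 'I_l),
  is_quantizer phi -> 0 <= Idet mu f m (lift m i) phi <= B.
Proof.
pose c i := fine (\int[mu]_x `|kl_integrand f m (lift m i) x|)%E.
have c0 i : 0 <= c i by apply: fine_ge0; exact: integral_ge0.
exists (\sum_i l%:R * c i) => i phi qphi; apply/andP; split.
  apply: (@le_trans _ _ (\sum_u (fq mu f m phi u - fq mu f (lift m i) phi u))).
    by rewrite sumrB !fq_sum1 // subrr.
  apply: ler_sum => u _.
  have := @kl_term_ge R (fq mu f m phi u) (fq mu f (lift m i) phi u) 1.
  rewrite ln1 add0r !mulr1; apply; rewrite ?fq_ge0 //.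
  exact: (fq_ac u qphi (neq_lift m i)).1.
rewrite (bigD1 i) //= ler_wpDr //.
  by apply: sumr_ge0 => j _; rewrite mulr_ge0.
rewrite mulr_natl -[l in _ *+ l]card_ord -sumr_const; apply: ler_sum => u _.
have mi := neq_lift m i.
apply: le_trans (kl_term_le mi (qphi u)) _.
have ik := hkl mi.
have ikA : mu.-integrable (phi @^-1` [set u]) (kl_integrand f m (lift m i)).
  by apply: integrableS ik.
have iabs : (\int[mu]_x `|kl_integrand f m (lift m i) x|)%E \is a fin_num.
  by apply: integrable_fin_num => //; exact: integrable_abse.
apply: fine_le => //; first exact: integrable_fin_num ikA.
apply: le_trans (lee_abs _) _.
have mk : measurable_fun setT (kl_integrand f m (lift m i)) by case/integrableP : ik.
apply: le_trans (le_abse_integral _ (qphi u) _) _.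
  by apply: measurable_funS mk.
by apply: ge0_subset_integral => //; exact: measurableT_comp.
Qed.

(** * Limits of quantizers *)

Lemma cvg_integral_cell (h : T -> \bar R) (phi_ : nat -> T -> 'I_l)
    (phi : T -> 'I_l) (u : 'I_l) :
  mu.-integrable setT h -> (forall n, is_quantizer (phi_ n)) -> is_quantizer phi ->
  {ae mu, forall x, h x != 0%E -> \forall n \near \oo, phi_ n x = phi x} ->
  (fine (\int[mu]_(x in phi_ n @^-1` [set u]) h x)%E) @[n --> \oo] -->
  fine (\int[mu]_(x in phi @^-1` [set u]) h x)%E.
Proof.
move=> ih qphi_ qphi hae.
have mh : measurable_fun setT h by case/integrableP : ih.
apply: fine_cvg; rewrite fineK; last first.
  by apply: integrable_fin_num => //; apply: integrableS ih.
under eq_cvg do rewrite integral_mkcond.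
rewrite integral_mkcond.
(* [abse \o h] dominates. Where [h] vanishes all restrictions are zero, so the labels have to settle
   only on the support of [h]. *)
have [] // := @dominated_convergence _ _ _ mu setT measurableT
  (fun n => h \_ (phi_ n @^-1` [set u])) (h \_ (phi @^-1` [set u])) (abse \o h).
- move=> n; apply/(measurable_restrict _ (qphi_ n u) measurableT).
  exact: measurable_funS mh.
- apply/(measurable_restrict _ (qphi u) measurableT).
  exact: measurable_funS mh.
- apply: filterS hae => x hx _.
  have [h0|h0] := eqVneq (h x) 0%E.
    rewrite (_ : (fun n => _) = cst 0%E); last first.
      by apply/funext => n; rewrite patchE h0; case: ifP.
    by rewrite patchE h0 if_same; exact: cvg_cst.
  apply: cvg_near_cst; apply: filterS (hx h0) => n e.
  rewrite !patchE; congr (if _ then _ else _).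
  by apply/idP/idP => /set_mem /= xu; apply/mem_set; rewrite /= -xu e.
- exact: integrable_abse.
- apply: nearW => x n _; rewrite patchE; case: ifP => _ //=.
  by rewrite normr0 abse_ge0.
Qed.

(* Where the limiting cell is null for [f m], continuity of [kl_term] fails and
   is replaced by the absolute continuity of the integral of [kl_integrand]. *)
Lemma Idet_usc (m m' : 'I_M) (phi_ : nat -> T -> 'I_l) (phi : T -> 'I_l)
    (eps : R) : m != m' ->
  (forall n, is_quantizer (phi_ n)) -> is_quantizer phi ->
  (forall k, {ae mu, forall x, f k x != 0 ->
     \forall n \near \oo, phi_ n x = phi x}) -> 0 < eps ->
  \forall n \near \oo, Idet mu f m m' (phi_ n) <= Idet mu f m m' phi + eps.
Proof.
move=> mm' qphi_ qphi hae eps0.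
have l0 : 0 < l%:R + 1 :> R by rewrite ltr_wpDl.
have cell u : \forall n \near \oo,
    kl_term (fq mu f m (phi_ n) u) (fq mu f m' (phi_ n) u) <=
    kl_term (fq mu f m phi u) (fq mu f m' phi u) + eps / (l%:R + 1).
  have e0 : 0 < eps / (l%:R + 1) by rewrite divr_gt0.
  have cq k : fq mu f k (phi_ n) u @[n --> \oo] --> fq mu f k phi u.
    apply: (@cvg_integral_cell (EFin \o f k)) => //.
    by apply: filterS (hae k) => x hx fx; apply: hx; move: fx; rewrite eqe.
  have [x0|x0] := eqVneq (fq mu f m phi u) 0.
    have -> : kl_term (fq mu f m phi u) (fq mu f m' phi u) = 0.
      by rewrite /kl_term x0 eqxx.
    rewrite add0r.
    have : (fine (\int[mu]_(x in phi_ n @^-1` [set u]) kl_integrand f m m' x)%E)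
        @[n --> \oo] -->
        fine (\int[mu]_(x in phi @^-1` [set u]) kl_integrand f m m' x)%E.
      apply: cvg_integral_cell => //; first exact: hkl.
      apply: filterS (hae m) => x hx kx; apply: hx; apply: contra_neq kx => fx.
      by rewrite /kl_integrand fx eqxx.
    have -> : (\int[mu]_(x in phi @^-1` [set u]) kl_integrand f m m' x = 0)%E.
      rewrite -(integral0 mu (phi @^-1` [set u])); apply: ae_eq_integral => //.
        by apply: measurable_funS (measurable_int _ (hkl mm')).
      have ik := integrable_density m.
      have := (Rintegral_eq0_ae (qphi u) (hfge0 m) ik).1 x0.
      by apply: filterS => x h Ax; rewrite /kl_integrand h // eqxx.
    move=> /cvgr_le /(_ _ e0); apply: filterS => n; apply: le_trans.
    exact: kl_term_le mm' (qphi_ n u).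
  (* Both limiting cell probabilities are now positive, so the logarithm of their ratio is
     continuous there. *)
  have y0 : fq mu f m' phi u != 0.
    by apply: contra_neq x0; exact: (fq_ac u qphi mm').1.
  have : fq mu f m (phi_ n) u * ln (fq mu f m (phi_ n) u / fq mu f m' (phi_ n) u)
      @[n --> \oo] --> kl_term (fq mu f m phi u) (fq mu f m' phi u).
    rewrite /kl_term (negbTE x0); apply: cvgM => //.
    apply: (cvg_comp (fun n => fq mu f m (phi_ n) u / fq mu f m' (phi_ n) u)
      (@ln R)); last first.
      apply: continuous_ln; rewrite divr_gt0 // lt_neqAle eq_sym ?x0 ?y0 /= ?fq_ge0 //.
    by apply: cvgM => //; apply: cvgV.
  move=> /cvgr_le /(_ (kl_term (fq mu f m phi u) (fq mu f m' phi u) +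
     eps / (l%:R + 1))).
  rewrite ltrDl => /(_ e0); apply: filterS2 (cvgr_neq0 _ (cq m) x0) => n xn.
  by rewrite /kl_term (negbTE xn) (negbTE x0).
have all_cells : \forall n \near \oo, forall u,
    kl_term (fq mu f m (phi_ n) u) (fq mu f m' (phi_ n) u) <=
    kl_term (fq mu f m phi u) (fq mu f m' phi u) + eps / (l%:R + 1).
  exact: filter_forall.
apply: filterS all_cells => n hn.
apply: (@le_trans _ _ (\sum_u (kl_term (fq mu f m phi u) (fq mu f m' phi u) +
  eps / (l%:R + 1)))).
  by apply: ler_sum => u _; exact: hn.
rewrite big_split /= lerD2l sumr_const card_ord -[leLHS]mulr_natl mulrCA.
rewrite ler_piMr ?(ltW eps0)// ler_pdivrMr // mul1r lerDl.
exact: ler01.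
Qed.

(* Almost every point avoids the ties of all the [phi_ n]; there the minimising
   label only depends on the signs of the score differences. *)
Lemma ULQ_sequential_compact (k : nat) (phi_ : nat -> 'I_k -> T -> 'I_l) :
  (0 < l)%N -> (forall n j, is_ULQ mu f (phi_ n j)) ->
  exists2 s : nat -> nat, increasing_seq s &
    exists phi : 'I_k -> T -> 'I_l, forall j, is_quantizer (phi j) /\
      forall m, {ae mu, forall x, f m x != 0 ->
        \forall n \near \oo, phi_ (s n) j x = phi j x}.
Proof.
move=> l0 ulq.
have qphi_ n j : is_quantizer (phi_ n j) by have [] := ulq n j.
have /choice[a aP] : forall nj : nat * 'I_k, exists a : 'I_l -> 'I_M -> R,
    (forall x v, lscore f a (phi_ nj.1 nj.2 x) x <= lscore f a v x) /\
    forall m, (\int[mu]_(x in tie_set f a) (f m x)%:E)%E = 0%E.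
  by move=> [n j]; have [_] := ulq n j.
(* The coefficients of all [k] quantizers form one vector, so a single subsequence serves every
   difference of scores at every point. *)
pose coef n (i : 'I_k * 'I_l * 'I_M) := a (n, i.1.1) i.1.2 i.2.
have [s si sP] := sign_subsequence coef.
exists s => //.
have label_stable j x : (forall n, ~ tie_set f (a (n, j)) x) ->
    exists u, \forall n \near \oo, phi_ (s n) j x = u.
  move=> notie.
  have dE n u v :
      \sum_i coef n i * ((i.1.1 == j)%:R * ((i.1.2 == u)%:R - (i.1.2 == v)%:R)
        * f i.2 x) = lscore f (a (n, j)) u x - lscore f (a (n, j)) v x.
    rewrite -(pair_bigA _ (fun i0 m => coef n (i0, m) * ((i0.1 == j)%:R *
      ((i0.2 == u)%:R - (i0.2 == v)%:R) * f m x))) /=.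
    rewrite -(pair_bigA _ (fun j' w => \sum_m coef n (j', w, m) * ((j' == j)%:R *
      ((w == u)%:R - (w == v)%:R) * f m x))) /=.
    rewrite (bigD1 j) //= [X in _ + X]big1 ?addr0; last first.
      move=> j' /negbTE j'j; rewrite big1 // => w _; rewrite big1 // => m _.
      by rewrite j'j !mul0r mulr0.
    transitivity (\sum_w ((w == u)%:R - (w == v)%:R) * lscore f (a (n, j)) w x).
      apply: eq_bigr => w _; rewrite /lscore mulr_sumr; apply: eq_bigr => m _.
      by rewrite eqxx mul1r /coef /=; ring.
    have pick1 (G : 'I_l -> R) w0 : \sum_w (w == w0)%:R * G w = G w0.
      rewrite (bigD1 w0) //= eqxx mul1r big1 ?addr0 // => w /negbTE ->.
      by rewrite mul0r.
    by under eq_bigr do rewrite mulrBl; rewrite sumrB !pick1.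
  have /choice[e eP] : forall p : 'I_l * 'I_l, exists e : R,
      \forall n \near \oo, Num.sg (lscore f (a (s n, j)) p.1 x -
        lscore f (a (s n, j)) p.2 x) = e.
    move=> p; have [e he] := sP (fun i => (i.1.1 == j)%:R *
      ((i.1.2 == p.1)%:R - (i.1.2 == p.2)%:R) * f i.2 x).
    by exists e; apply: filterS he => n <-; rewrite dE.
  have [N _ NP] : \forall n \near \oo, forall p : 'I_l * 'I_l,
      Num.sg (lscore f (a (s n, j)) p.1 x - lscore f (a (s n, j)) p.2 x) = e p.
    exact: filter_forall.
  (* By equality of signs the label [u] chosen at rank [N] minimises the scores at all later ranks,
     so a different choice there would be a tie. *)
  pose u := phi_ (s N) j x; exists u; exists N => // n /= Nn.
  apply/eqP/negPn/negP => nu; apply: (notie (s n)).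
  have umin v : lscore f (a (s n, j)) u x <= lscore f (a (s n, j)) v x.
    have := NP n Nn (u, v); rewrite -(NP N (leqnn N) (u, v)) /= => sgE.
    by rewrite -subr_le0 -sgr_le0 sgE sgr_le0 subr_le0; apply: (aP (s N, j)).1.
  exists (phi_ (s n) j x), u; split => //; split; last exact: (aP (s n, j)).1.
  by apply/le_anti; rewrite umin (aP (s n, j)).1.
(* [F] reads off the eventual label, and returns a default label where there is none; the latter
   points are negligible by the absence of ties. *)
pose B j u := [set x | \forall n \near \oo, phi_ (s n) j x = u].
pose F (S : {set 'I_l}) := odflt (Ordinal l0) [pick u in S].
exists (fun j x => F (finset (fun u => x \in B j u))) => j; split.
  apply: quantizer_select => u.
  rewrite (_ : B j u =
    \bigcup_N \bigcap_(n in [set n | (N <= n)%N]) (phi_ (s n) j @^-1` [set u])).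
    by apply: bigcup_measurable => N _; apply: bigcap_measurable => [|n _];
      [exists N => /=|exact: qphi_].
  by apply/seteqP; split => x [N _ NP]; exists N.
move=> m.
have tie_ae n : {ae mu, forall x, tie_set f (a (n, j)) x -> f m x = 0}.
  apply/Rintegral_eq0_ae => //; first exact: measurable_tie_set.
  by rewrite /Rintegral (aP (n, j)).2.
apply: filterS (ae_foralln tie_ae) => x tx fx.
have [|u hu] := label_stable j x.
  by move=> n /tx/eqP; rewrite (negbTE fx).
rewrite /F; case: pickP => [v|/(_ u)].
  by rewrite finset.inE => /set_mem.
by rewrite finset.inE => /negbT/negP[]; apply/mem_set.
Qed.

(** * Approximating and attaining the maximin value *)

Lemma le_Imin (m : 'I_M) p (phi : nat -> T -> 'I_l) (c : \bar R) :
  (c <= Imin mu f m p phi)%E <->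
  forall i, (c <= Irand mu f m (lift m i) p phi)%E.
Proof.
split=> [h i|h].
  by apply: le_trans h _; apply: bigmin_le_cond; rewrite eq_sym neq_lift.
apply: le_bigmin; first exact: leey.
by move=> m'; case: (unliftP m m') => [i -> _|->]; [exact: h|rewrite eqxx].
Qed.

(** Beyond [k] the weights are padded with zero and the components with a member of [S], so that
    every component satisfies [S] and the series reduce to finite sums. *)
Lemma mixture_rq (S : (T -> 'I_l) -> Prop) (k : nat) (w : 'I_k -> R)
    (s : 'I_k -> T -> 'I_l) :
  (0 < k)%N -> (forall phi, S phi -> is_quantizer phi) -> mixture S w s ->
  exists p : nat -> R, exists phi : nat -> T -> 'I_l,
    [/\ is_rq p phi, forall j, (k <= j)%N -> p j = 0, forall j, S (phi j) &
      forall m m', Irand mu f m m' p phi =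
        (\sum_j w j * Idet mu f m m' (s j))%:E].
Proof.
move=> k0 Sq [w0 w1 sS].
pose p j : R := if insub j is Some i then w i else 0.
pose phi j := if insub j is Some i then s i else s (Ordinal k0).
have Sphi j : S (phi j) by rewrite /phi; case: insub.
exists p, phi; split => // [|j kj|m m'].
- split => [j||j]; first by rewrite /p; case: insub.
    by rewrite nneseries_insub w1.
  exact: Sq.
- by rewrite /p insubF // ltnNge kj.
rewrite /Irand -nneseries_insub; apply: eq_eseriesr => j _.
by rewrite /p /phi; case: insub => // ; rewrite mul0r.
Qed.

(** If every component fell short of the bound, so would a long truncation of the series, although
    its priced information is nearly [c] times the total price. *)
Lemma rq_exists_above (m : 'I_M) p (phi : nat -> T -> 'I_l) (c : R)
    (lam : 'I_M.-1 -> R) (eps : R) :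
  is_rq p phi -> (c%:E <= Imin mu f m p phi)%E ->
  (forall i, 0 <= lam i) -> 0 < eps ->
  exists j, c * (\sum_i lam i) - eps <=
    \sum_i lam i * Idet mu f m (lift m i) (phi j).
Proof.
move=> [p0 p1 qphi] /le_Imin cI lam0 eps0.
set L := \sum_i lam i.
have L0 : 0 <= L by apply: sumr_ge0.
have [B IB] := Idet_bounded m.
apply: contrapT => /forallNP none.
pose kap := c * L - eps.
have below j : \sum_i lam i * Idet mu f m (lift m i) (phi j) <= kap.
  by rewrite leNgt; apply/negP => /ltW/none.
have cvgp : \sum_(0 <= j < n) p j @[n --> \oo] --> (1 : R).
  have : (\sum_(0 <= j < n) (p j)%:E)%E @[n --> \oo] --> (1%:E : \bar R).
    by rewrite -p1; apply: is_cvg_nneseries => j _ _; rewrite lee_fin.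
  by move/fine_cvg; apply: cvg_trans; apply: near_eq_cvg; apply: nearW => n /=;
    rewrite sumEFin.
(* Lowering [c] by [e] for every state costs at most [eps / 2] in the priced sum; the extra 1 covers
   the case of zero prices. *)
pose e := eps / (2 * (L + 1)).
have e0 : 0 < e by rewrite divr_gt0 // mulr_gt0 // ltr_wpDl.
have eL : e * L <= eps / 2.
  rewrite /e mulrAC ler_pdivrMr ?mulr_gt0 ?ltr_wpDl //.
  rewrite (_ : eps / 2 * _ = eps * (L + 1)); last by field.
  by rewrite ler_pM2l // lerDl.
have cvgI i : \forall n \near \oo,
    c - e <= \sum_(0 <= j < n) p j * Idet mu f m (lift m i) (phi j).
  have pI0 j : 0 <= p j * Idet mu f m (lift m i) (phi j).
    by rewrite mulr_ge0 //; have /andP[] := IB i _ (qphi j).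
  have nd : {homo (fun n => (\sum_(0 <= j < n)
      (p j * Idet mu f m (lift m i) (phi j))%:E)%E) : a b / (a <= b)%N >-> (a <= b)%E}.
    by apply: ereal_nondecreasing_series => j _ _; rewrite lee_fin.
  have := @lte_lim R _ (c - e) nd; rewrite -/(Irand mu f m (lift m i) p phi).
  have lt : ((c - e)%:E < Irand mu f m (lift m i) p phi)%E.
    by apply: lt_le_trans (cI i); rewrite lte_fin ltrBlDr ltrDl.
  move=> /(_ (is_cvg_nneseries _) lt) H; apply: filterS (H _) => [n|j _ _].
    by rewrite sumEFin lee_fin.
  by rewrite lee_fin.
have all_i : \forall n \near \oo, forall i,
    c - e <= \sum_(0 <= j < n) p j * Idet mu f m (lift m i) (phi j).
  exact: filter_forall.
(* [kap] may be negative, so a truncated mass below one can raise the bound; convergence of the mass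
   to one limits this to [eps / 2]. *)
have kp : \forall n \near \oo, kap * \sum_(0 <= j < n) p j < kap + eps / 2.
  have : kap * \sum_(0 <= j < n) p j @[n --> \oo] --> kap * 1.
    exact: cvgMl_tmp.
  by move/cvgr_lt; apply; rewrite mulr1 ltrDl divr_gt0.
have [N [/= N1 N2]] : exists n,
    (forall i, c - e <= \sum_(0 <= j < n) p j * Idet mu f m (lift m i) (phi j)) /\
    kap * \sum_(0 <= j < n) p j < kap + eps / 2.
  case: all_i kp => [N1 _ h1] [N2 _ h2]; exists (maxn N1 N2).
  by split; [apply: h1; rewrite /= leq_maxl|apply: h2; rewrite /= leq_maxr].
have h1 : (c - e) * L <= \sum_i lam i *
    \sum_(0 <= j < N) p j * Idet mu f m (lift m i) (phi j).
  by rewrite mulrC mulr_suml; apply: ler_sum => i _; rewrite ler_wpM2l.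
have h2 : \sum_i lam i * \sum_(0 <= j < N) p j * Idet mu f m (lift m i) (phi j)
    <= kap * \sum_(0 <= j < N) p j.
  under eq_bigr do rewrite mulr_sumr.
  rewrite exchange_big /= mulr_sumr; apply: ler_sum => j _.
  under eq_bigr do rewrite mulrCA.
  by rewrite -mulr_sumr mulrC ler_wpM2r.
have := le_lt_trans (le_trans h1 h2) N2; apply/negP; rewrite -leNgt /kap.
rewrite mulrBl; lra.
Qed.

Lemma ULQ_mixture_approx (m : 'I_M) p (phi : nat -> T -> 'I_l) (c eps : R) :
  (0 < l)%N -> (1 < M)%N -> is_rq p phi -> (c%:E <= Imin mu f m p phi)%E ->
  0 < eps ->
  exists w : 'I_M.-1 -> R, exists s : 'I_M.-1 -> T -> 'I_l,
    mixture (is_ULQ mu f) w s /\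
    forall i, c - eps <= \sum_j w j * Idet mu f m (lift m i) (s j).
Proof.
move=> l0 M1 rq cI eps0.
have k0 : (0 < M.-1)%N by case: (M) M1 => [|[]].
have qphi : forall j, is_quantizer (phi j) by case: rq.
have [B IB] := Idet_bounded m.
have ULQ_q (psi : T -> 'I_l) : is_ULQ mu f psi -> is_quantizer psi by case.
have [psi0 Upsi0 _] := ULQ_approx (fun _ _ => 0) l0 (qphi 0%N) ltr01.
have [||lam e lam0 e0||n [w [s [mix hw]]]] := @mixture_minimax R (T -> 'I_l)
    (is_ULQ mu f) M.-1 (fun psi i => Idet mu f m (lift m i) psi) B c _ _ _ eps.
- by move=> psi i /ULQ_q/(IB i)/andP[I0 I1]; rewrite ger0_norm.
- by exists psi0.
(* Half of the slack pays for picking one component [phi j], the other half for replacing it by a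
   ULQ that nearly maximises the linear minorant exact at [phi j]. *)
- have e2 : 0 < e / 2 by rewrite divr_gt0.
  have [j hj] := rq_exists_above rq cI lam0 e2.
  have [g [gE gle]] := Idet_linear_le m lam0 (qphi j).
  have [psi Upsi hpsi] := ULQ_approx g l0 (qphi j) e2.
  exists psi => //; have := gle _ (ULQ_q _ Upsi); rewrite gE in hpsi.
  lra.
- by [].
exact: (@mixture_resize _ _ _ _ _
  (fun psi i => Idet mu f m (lift m i) psi) _ _ _ k0 mix hw).
Qed.

(** A constant quantizer gives the lower bound 0. A value above [B + 1] would yield, by
    approximation with error 1, a mixture whose informations exceed the bound [B] of its
    components. *)
Lemma Isup_fin_num (m : 'I_M) : (0 < l)%N -> (1 < M)%N ->
  Isup mu l f m \is a fin_num.
Proof.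
move=> l0 M1.
have k0 : (0 < M.-1)%N by case: (M) M1 => [|[]].
have [B IB] := Idet_bounded m.
have ULQ_q (psi : T -> 'I_l) : is_ULQ mu f psi -> is_quantizer psi by case.
rewrite fin_numE; apply/andP; split.
- pose cst0 : T -> 'I_l := fun=> Ordinal l0.
  have qcst : is_quantizer cst0.
    by move=> u; rewrite preimage_cst; case: ifP.
  have mix : mixture (@is_quantizer d T l) (fun=> 1 : R) (fun _ : 'I_1 => cst0).
    by split => //; rewrite big_ord1.
  have [p [phi [rq _ _ IE]]] := mixture_rq (k := 1) isT (fun _ h => h) mix.
  rewrite -ltNye; apply: lt_le_trans (ltNyr 0) _.
  apply: (@le_trans _ _ (Imin mu f m p phi)); last first.
    by apply: ereal_sup_ubound; exists (p, phi).
  apply/le_Imin => i; rewrite IE lee_fin big_ord1 mul1r.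
  by have /andP[] := IB i _ qcst.
- rewrite -ltey; apply: le_lt_trans (ltry (B + 1)).
  apply: ge_ereal_sup => _ [[p phi] /= rq <-].
  rewrite leNgt; apply/negP => BI.
  have [c Bc cI] : exists2 c, B + 1 < c & (c%:E <= Imin mu f m p phi)%E.
    case: (Imin mu f m p phi) BI => [r||] //= BI.
      by exists r.
    by exists (B + 2); [rewrite ltrD2l ltr1n|rewrite leey].
  have [w [s [[w0 w1 sU] hw]]] := ULQ_mixture_approx l0 M1 rq cI ltr01.
  have : \sum_j w j * Idet mu f m (lift m (Ordinal k0)) (s j) <= B.
    rewrite -[leRHS]mul1r -w1 mulr_suml; apply: ler_sum => j _.
    by rewrite ler_wpM2l //; have /andP[] := IB (Ordinal k0) _ (ULQ_q _ (sU j)).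
  have := hw (Ordinal k0); lra.
Qed.

Lemma ULQ_mixture_sequence (m : 'I_M) : (0 < l)%N -> (1 < M)%N ->
  exists w : nat -> 'I_M.-1 -> R, exists s : nat -> 'I_M.-1 -> T -> 'I_l,
    forall n, mixture (is_ULQ mu f) (w n) (s n) /\
    forall i, fine (Isup mu l f m) - n.+1%:R^-1 <=
      \sum_j w n j * Idet mu f m (lift m i) (s n j).
Proof.
move=> l0 M1; have IF := Isup_fin_num m l0 M1.
have /choice[ws wsP] : forall n,
    exists ws : ('I_M.-1 -> R) * ('I_M.-1 -> T -> 'I_l),
    mixture (is_ULQ mu f) ws.1 ws.2 /\
    forall i, fine (Isup mu l f m) - n.+1%:R^-1 <=
      \sum_j ws.1 j * Idet mu f m (lift m i) (ws.2 j).
  (* Half of the error goes into the choice of a near-optimal quantizer, half into its approximation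
     by ULQs. *)
  move=> n; pose e : R := n.+1%:R^-1 / 2.
  have e0 : 0 < e by rewrite divr_gt0 // invr_gt0.
  have : ((fine (Isup mu l f m) - e)%:E < Isup mu l f m)%E.
    by rewrite -{2}(fineK IF) lte_fin ltrBlDr ltrDl.
  move=> /ereal_sup_gt[_ [[p phi] /= rq <-] /ltW cI].
  have [w [s [mix hw]]] := ULQ_mixture_approx l0 M1 rq cI e0.
  exists (w, s); split => // i; apply: le_trans (hw i).
  by rewrite -addrA -opprD -splitr.
by exists (fun n => (ws n).1), (fun n => (ws n).2).
Qed.

Lemma ULQ_approximation (m : 'I_M) : (0 < l)%N -> (1 < M)%N ->
  exists (p : nat -> nat -> R) (phi : nat -> nat -> T -> 'I_l),
    (forall i, [/\ is_rq (p i) (phi i),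
                   (forall j, (M.-1 <= j)%N -> p i j = 0) &
                   (forall j, (j < M.-1)%N -> is_ULQ mu f (phi i j))]) /\
    (fun i => Imin mu f m (p i) (phi i)) @ \oo --> Isup mu l f m.
Proof.
move=> l0 M1; have k0 : (0 < M.-1)%N by case: (M) M1 => [|[]].
have IF := Isup_fin_num m l0 M1.
have [w [s ws]] := ULQ_mixture_sequence m l0 M1.
have ULQ_q (psi : T -> 'I_l) : is_ULQ mu f psi -> is_quantizer psi by case.
have /choice[pp ppP] : forall n, exists pp : (nat -> R) * (nat -> T -> 'I_l),
    [/\ is_rq pp.1 pp.2, forall j, (M.-1 <= j)%N -> pp.1 j = 0,
      forall j, is_ULQ mu f (pp.2 j) &
      ((fine (Isup mu l f m) - n.+1%:R^-1)%:E <= Imin mu f m pp.1 pp.2)%E].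
  move=> n; have [mix hw] := ws n.
  have [p [phi [rq pz pU IE]]] := mixture_rq k0 ULQ_q mix.
  by exists (p, phi); split => //; apply/le_Imin => i; rewrite IE lee_fin.
exists (fun n => (pp n).1), (fun n => (pp n).2); split.
  by move=> n; have [rq pz pU _] := ppP n; split => // j _.
apply: (@squeeze_cvge _ _ _ _
  (fun n => (fine (Isup mu l f m) - n.+1%:R^-1)%:E) _ (cst (Isup mu l f m))).
- apply: nearW => n; have [rq _ _ ->] := ppP n; rewrite /=.
  by apply: ereal_sup_ubound; exists (pp n) => //; case: (pp n) rq.
- rewrite -[X in _ --> X](fineK IF); apply: cvg_EFin; first exact: nearW.
  rewrite -[X in _ --> X]subr0; apply: cvgB; first exact: cvg_cst.
  exact: cvg_harmonic.
- exact: cvg_cst.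
Qed.

(** Along a subsequence, near-optimal ULQ mixtures have converging weights and almost everywhere
    converging components; by upper semicontinuity the limiting mixture attains [Isup]. *)
Lemma maximin_quantizer (m : 'I_M) : (0 < l)%N -> (1 < M)%N ->
  exists (p : nat -> R) (phi : nat -> T -> 'I_l),
    [/\ is_rq p phi,
        (forall j, (M.-1 <= j)%N -> p j = 0) &
        Imin mu f m p phi = Isup mu l f m].
Proof.
move=> l0 M1; have k0 : (0 < M.-1)%N by case: (M) M1 => [|[]].
have IF := Isup_fin_num m l0 M1; set W := fine (Isup mu l f m).
have [w_ [s_ ws]] := ULQ_mixture_sequence m l0 M1.
have [|t ti [phi phiP]] := @ULQ_sequential_compact M.-1 s_ l0.
  by move=> n j; have [[_ _ sU] _] := ws n.
have w01 n j : 0 <= w_ n j <= 1.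
  have [[w0 w1 _] _] := ws n; rewrite w0 -w1 (bigD1 j) //= lerDl.
  exact: sumr_ge0.
have [|r ri [w wcvg]] := @bolzano_weierstrass_fin R _ (fun n => w_ (t n)) 1.
  by move=> n j; have /andP[h0 h1] := w01 (t n) j; rewrite ger0_norm.
have mix : mixture (@is_quantizer d T l) w phi.
  split => [j||j]; last by have [] := phiP j.
    apply: (cvgr_to_ge (wcvg j)).
    by apply: nearW => n; have /andP[] := w01 (t (r n)) j.
  have : \sum_j w_ (t (r n)) j @[n --> \oo] --> \sum_j w j.
    by apply: cvg_sumr => j; exact: wcvg.
  move=> h; apply: (cvg_unique _ h) => //.
  rewrite (_ : (fun n => _) = cst 1); first exact: cvg_cst.
  by apply/funext => n; have [[_ ->]] := ws (t (r n)).
have [p [psi [rq pz _ IE]]] := mixture_rq k0 (fun _ h => h) mix.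
exists p, psi; split => //; apply/le_anti/andP; split.
  by apply: ereal_sup_ubound; exists (p, psi).
apply/le_Imin => i; rewrite IE -(fineK IF) lee_fin -/W.
apply/ler_addgt0Pr => e e0.
(* One third each is spent on upper semicontinuity of the informations, on convergence of the
   weights, and on the distance of the mixtures from the supremum. *)
have e3 : 0 < e / 3 by rewrite divr_gt0.
have tr := increasing_seq_comp ti ri.
have near_I : \forall n \near \oo, forall j,
    Idet mu f m (lift m i) (s_ (t n) j) <=
    Idet mu f m (lift m i) (phi j) + e / 3.
  apply: filter_forall => j; have [qj aej] := phiP j.
  apply: Idet_usc => //; first exact: neq_lift.
  by move=> n; have [[_ _ sU] _] := ws (t n); have [] := sU j.
have near_Ir : \forall n \near \oo, forall j,
    Idet mu f m (lift m i) (s_ (t (r n)) j) <=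
    Idet mu f m (lift m i) (phi j) + e / 3.
  exact: (increasing_seq_cvgn ri near_I).
have near_w : \forall n \near \oo,
    \sum_j w_ (t (r n)) j * Idet mu f m (lift m i) (phi j) <=
    \sum_j w j * Idet mu f m (lift m i) (phi j) + e / 3.
  have h : \sum_j w_ (t (r n)) j * Idet mu f m (lift m i) (phi j) @[n --> \oo]
      --> \sum_j w j * Idet mu f m (lift m i) (phi j).
    by apply: cvg_sumr => j; apply: cvgMr_tmp; exact: wcvg.
  by move/cvgr_le : h; apply; rewrite ltrDl.
have near_h : \forall n \near \oo, (t (r n)).+1%:R^-1 <= e / 3 :> R.
  have h : \forall n \near \oo, n.+1%:R^-1 <= e / 3 :> R.
    by have := near_infty_natSinv_lt (PosNum e3); apply: filterS => n /ltW.
  exact: (increasing_seq_cvgn tr h).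
case: near_Ir near_w near_h => [N1 _ h1] [N2 _ h2] [N3 _ h3].
pose n := maxn N1 (maxn N2 N3).
have {}h1 := h1 n (leq_maxl _ _).
have {}h2 := h2 n (leq_trans (leq_maxl _ _) (leq_maxr _ _)).
have {}h3 := h3 n (leq_trans (leq_maxr _ _) (leq_maxr _ _)).
have [[w0 w1 _] /(_ i)] := ws (t (r n)); rewrite -/W => hW.
have h4 : \sum_j w_ (t (r n)) j * Idet mu f m (lift m i) (s_ (t (r n)) j) <=
    \sum_j w_ (t (r n)) j * Idet mu f m (lift m i) (phi j) + e / 3.
  rewrite [X in _ <= _ + X](_ : _ = \sum_j w_ (t (r n)) j * (e / 3)); last first.
    by rewrite -mulr_suml w1 mul1r.
  rewrite -big_split /=.
  by apply: ler_sum => j _; rewrite -mulrDr; apply: ler_wpM2l => //; exact: h1.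
rewrite /= in h2 h3; move: h3 hW; move: ((t (r n)).+1%:R^-1 : R) => x h3 hW.
lra.
Qed.

End Densities.

Theorem theorem5p1 (R : realType) (d : measure_display) (T : measurableType d)
  (mu : {measure set T -> \bar R}) (M l : nat) (f : 'I_M -> T -> R)
  (hl : (2 <= l)%N) (hM : (2 <= M)%N)
  (hsf : sigma_finite setT mu)
  (hfmeas : forall m, measurable_fun setT (f m))
  (hfge0 : forall m x, 0 <= f m x)
  (hfprob : forall m, (\int[mu]_x (f m x)%:E)%E = 1%E)
  (hkl : forall m m' : 'I_M, m != m' ->
     mu.-integrable setT (kl_integrand f m m') /\
     (0 < \int[mu]_x kl_integrand f m m' x)%E) :
  forall m : 'I_M,
    (exists (p : nat -> R) (phi : nat -> T -> 'I_l),
       [/\ is_rq p phi,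
           (forall j, (M.-1 <= j)%N -> p j = 0) &
           Imin mu f m p phi = Isup mu l f m]) /\
    (exists (p : nat -> nat -> R) (phi : nat -> nat -> T -> 'I_l),
       (forall i, [/\ is_rq (p i) (phi i),
                      (forall j, (M.-1 <= j)%N -> p i j = 0) &
                      (forall j, (j < M.-1)%N -> is_ULQ mu f (phi i j))]) /\
       (fun i => Imin mu f m (p i) (phi i)) @ \oo --> Isup mu l f m).
Proof.
have l0 : (0 < l)%N by exact: ltnW.
have ik m m' : m != m' -> mu.-integrable setT (kl_integrand f m m').
  by move=> /hkl[].
move=> m; split.
  exact: (maximin_quantizer hfmeas hfge0 hfprob ik m l0 hM).
exact: (ULQ_approximation hfmeas hfge0 hfprob ik m l0 hM).
Qed.
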